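(* Let $t$ be a non-negative real number other than $\gamma^-$ and $\gamma^+$. For every large enough integer $d$ (that is, for every integer $d$ greater than some threshold depending on $t$), the difference $I_{d+1}(t)-I_d(t)$ is positive when $0\leq t<\gamma^-$ or $\gamma^+<t$, and negative when $\gamma^-<t<\gamma^+$.
   Context: For a positive integer $d$ and a non-negative real number $t$, $I_d(t)$ denotes the $(d-1)$-dimensional volume of $H\cap[0,1]^d$ where $H$ is a hyperplane of $\mathbb{R}^d$ that is orthogonal to a diagonal of the hypercube $[0,1]^d$ (a segment joining two opposite vertices, for instance the one in direction $(1,\ldots,1)$) and whose Euclidean distance to the center of $[0,1]^d$ is equal to $t$. By symmetry, this does not depend on the choice of such an $H$. The volume is $0$ when the intersection is empty. The numbers $\gamma^-$ and $\gamma^+$ are the two non-negative roots of $1-24t^2+48t^4$, namely $$ \gamma^\pm=\frac{1}{2}\sqrt{1\pm\sqrt{\frac{2}{3}}}. $$ *)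

(* Defs.v *)
From mathcomp Require Import all_boot all_order all_algebra.
From mathcomp Require Import all_classical all_reals all_analysis.

Set Implicit Arguments.
Unset Strict Implicit.
Unset Printing Implicit Defensive.

Import Order.TTheory GRing.Theory Num.Theory.

Local Open Scope classical_set_scope.
Local Open Scope ring_scope.

Section Euclidean.
Context {R : realType}.

Definition dotrv n (u v : 'rV[R]_n) : R := (u *m v^T) 0 0.

(* The library norm on ['rV[R]_n] is the sup norm, hence a separate notion. *)
Definition eucl_norm n (u : 'rV[R]_n) : R := Num.sqrt (dotrv u u).

Definition eucl_dist n (x : 'rV[R]_n) (A : set 'rV[R]_n) : R :=
  inf [set eucl_norm (y - x) | y in A].

(* The [n]-dimensional Lebesgue measure as the iterated product measure
   [lebesgue_measure \x (lebesgue_measure \x ...)], i.e. the integral of the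
   measures of the sections along the first coordinate (this is how the library
   defines [\x]). In dimension 0 it is the unit mass at the only point. It is
   the Lebesgue measure on Borel sets, and only meaningful there. *)
Fixpoint lebesgue_rv n : set 'rV[R]_n -> \bar R :=
  match n with
  | 0 => fun A => (\1_A 0)%:E
  | m.+1 => fun A => (\int[@lebesgue_measure R]_x
      lebesgue_rv [set y : 'rV[R]_m | A (row_mx (const_mx x : 'rV[R]_1) y)])%E
  end.

Definition hyperplane n (p w : 'rV[R]_n) : set 'rV[R]_n :=
  [set x | dotrv (x - p) w = 0].

(* [y |-> p + y *m B] is an isometry from R^(n-1) onto [H]: the rows of [B]
   form an orthonormal basis of the direction of [H]. *)
Definition isometric_chart n (H : set 'rV[R]_n)
    (p : 'rV[R]_n) (B : 'M[R]_(n.-1, n)) : Prop :=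
  B *m B^T = 1%:M /\ range (fun y : 'rV[R]_n.-1 => p + y *m B) = H.

(* The [(n-1)]-dimensional volume of a bounded Borel subset [A] of a hyperplane
   [H] of R^n: the Lebesgue measure of [A] read in an isometric chart of [H].
   It does not depend on the chart, so that [xget] selects the only candidate. *)
Definition hyperplane_volume n (H A : set 'rV[R]_n) : R :=
  xget 0 [set v : R | exists p B, isometric_chart H p B /\
    v = fine (lebesgue_rv [set y : 'rV[R]_n.-1 | A (p + y *m B)])].

End Euclidean.

Section Hypercube.
Context {R : realType}.

Definition hypercube d : set 'rV[R]_d :=
  [set x | forall i, 0 <= x 0 i <= 1].
Arguments hypercube d _ : clear implicits.

Definition hypercube_center d : 'rV[R]_d := const_mx 2^-1.

Definition is_vertex d (a : 'rV[R]_d) : Prop :=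
  forall i, a 0 i = 0 \/ a 0 i = 1.

Definition opposite_vertex d (a : 'rV[R]_d) : 'rV[R]_d := const_mx 1 - a.

Definition diagonal_hyperplane d (t : R) (H : set 'rV[R]_d) : Prop :=
  exists a p, [/\ is_vertex a, H = hyperplane p (opposite_vertex a - a) &
    eucl_dist (hypercube_center d) H = t].

(* I_d(t), for d > 0 and t >= 0. By symmetry all the hyperplanes [H] give
   the same volume, so that [xget] selects the only candidate. *)
Definition section_volume d (t : R) : R :=
  xget 0 [set v : R | exists2 H : set 'rV[R]_d, diagonal_hyperplane t H &
    v = hyperplane_volume H (H `&` hypercube d)].

Definition gamma_minus : R := 2^-1 * Num.sqrt (1 - Num.sqrt (2 / 3)).

Definition gamma_plus : R := 2^-1 * Num.sqrt (1 + Num.sqrt (2 / 3)).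

End Hypercube.

Arguments gamma_minus R : clear implicits.
Arguments gamma_plus R : clear implicits.

(* Main.v *)
Require Import Defs.
From HB Require Import structures.
From mathcomp Require Import all_boot all_order all_fingroup all_algebra.
From mathcomp Require Import all_classical all_reals all_analysis.
From mathcomp Require Import measurable_realfun ring lra.

(** Forgetting one coordinate maps the section of the cube of dimension
[d = n + 1] at distance [t] from the center onto the slab of [[0,1]^n] where
[|c - sum_i e_i (z_i - 1/2)| <= 1/2], with [c = t sqrt d] and signs [e_i], and
divides volumes by [sqrt d] ([section_volumeE]).  The volume of that slab is
the density at [c] of a sum of [d] independent uniform variables on
[[-1/2, 1/2]], whose characteristic functions are of the form [sinc].  Adding a
variable averages the density over a unit interval, which multiplies its
Fourier transform by [sinc]; hence, by induction on the dimension from the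
explicit Fourier transform of [sinc^2] ([vol_slab]), Polya's formula
[[
  I_d(t) = W^-1 \int sinc (v / sqrt d)^d cos (2 t v) dv,  W = \int sinc^2
]]
([section_volume_integral]).

Since [ln (sinc x) = - x^2/6 - x^4/180 - x^6/2835 - ...], the integrand is
[e^(-v^2/6) (1 - v^4/(180 d) + Q(v)/d^2) cos (2 t v)] with an explicit
polynomial [Q], up to an error which is [O(d^-3)] even after multiplication by
[1 + v^2], uniformly in [v] ([sinc_pow_approx]).  Integrating,
[[
  I_d(t) = a0 - a1 / d + a2 / d^2 + O(d^-3),
  a1 = (180 W)^-1 \int v^4 e^(-v^2/6) cos (2 t v) dv
]]
([section_volume_expansion]).  The expansion goes one order beyond [1/d] because
the difference [I_(d+1) - I_d] is only of order [d^-2]: it equals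
[a1 / (d (d + 1)) + O(d^-3)], which for large [d] has the sign of [a1]
([eventually_increasing]).

Integration by parts makes [a1] a positive multiple of
[(1 - 24 t^2 + 48 t^4) C(2 t)] with [C(b) = \int e^(-v^2/6) cos (b v) dv]
([gauss_moment4]), and [C > 0] because [C] solves [C' = - 3 b C] with [C(0) > 0]
([gauss_fourier_gt0]).  The quartic is [48 (t^2 - a^2) (t^2 - b^2)] where [a]
and [b] are the two exceptional values of [t]. *)

Set Implicit Arguments.
Unset Strict Implicit.
Unset Printing Implicit Defensive.

Import Order.TTheory GRing.Theory Num.Theory.
Import numFieldNormedType.Exports.

Local Open Scope classical_set_scope.
Local Open Scope ring_scope.

(** * Affine changes of variables on the line *)

Section affine_line.
Context {R : realType}.
Local Notation mu := (@lebesgue_measure R).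

Let affine (a b : R) (x : measurableTypeR R) : measurableTypeR R := a * x + b.

Let measurable_affine (a b : R) : measurable_fun setT (affine a b).
Proof.
apply: measurable_funD; last exact: measurable_cst.
exact: measurable_funM.
Qed.

(** By uniqueness of the Lebesgue measure: the right-hand side is a measure in
[A] with the right value on intervals. *)
Lemma lebesgue_measure_affine (a b : R) (A : set R) : a != 0 -> measurable A ->
  mu A = (`|a|%:E * mu ((fun x => (a * x + b)%R) @^-1` A))%E.
Proof.
move=> a0 mA.
have hm := measurable_affine a b.
pose m h : {measure set (measurableTypeR R) -> \bar R} :=
  mscale (NngNum (normr_ge0 a)) (@measure_function_pushforward__canonical__measure_function_Measure _ _ _ _ _ mu (affine a b) h).
rewrite (@lebesgue_measure_unique _ (m hm))// => _ [[p q]] _ <-.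
rewrite /= /mscale /= /pushforward /=.
have [a_gt0|a_lt0|a_eq0] := ltrgt0P a; last by rewrite a_eq0 eqxx in a0.
- rewrite (_ : _ @^-1` _ = `](p - b) / a, (q - b) / a]%classic); last first.
    apply/seteqP; split => x /=; rewrite /affine !in_itv/= ltr_pdivrMr// ler_pdivlMr//; lra.
  rewrite lebesgue_measure_itv lebesgue_measure_itv /= !lte_fin.
  rewrite ltr_pM2r ?invr_gt0// ltrD2r; case: ifPn => pq; last by rewrite mule0.
  by rewrite -!EFinD -EFinM; congr EFin; field.
- rewrite (_ : _ @^-1` _ = `[(q - b) / a, (p - b) / a[%classic); last first.
    apply/seteqP; split => x /=; rewrite /affine !in_itv/= ltr_ndivlMr// ler_ndivrMr//; lra.
  rewrite lebesgue_measure_itv lebesgue_measure_itv /= !lte_fin.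
  rewrite ltr_nM2r ?invr_lt0// ltrD2r; case: ifPn => pq; last by rewrite mule0.
  by rewrite -!EFinD -EFinM; congr EFin; field.
Qed.

Lemma ge0_integral_affine (a b : R) (f : R -> \bar R) : a != 0 ->
  measurable_fun setT f -> (forall x, 0 <= f x)%E ->
  (\int[mu]_x f x = `|a|%:E * \int[mu]_x f (a * x + b)%R)%E.
Proof.
move=> a0 mf f0.
have hm := measurable_affine a b.
pose m h : {measure set (measurableTypeR R) -> \bar R} :=
  mscale (NngNum (normr_ge0 a)) (@measure_function_pushforward__canonical__measure_function_Measure _ _ _ _ _ mu (affine a b) h).
rewrite (eq_measure_integral (m hm)).
  rewrite ge0_integral_mscale//=; congr (_ * _)%E.
  by rewrite ge0_integral_pushforward.
by move=> A mA _; exact: (@lebesgue_measure_affine a b).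
Qed.

Lemma Rintegral_affine (a b : R) (f : R -> R) : a != 0 ->
  mu.-integrable setT (EFin \o f) ->
  mu.-integrable setT (fun x => (f (a * x + b))%:E) /\
  (\int[mu]_x f x = `|a| * \int[mu]_x f (a * x + b))%R.
Proof.
move=> a0 If.
have mf : measurable_fun setT (EFin \o f) by apply: measurable_int If.
have mf' : measurable_fun setT (fun x => (f (a * x + b))%:E).
  exact: (measurableT_comp mf (measurable_affine a b)).
have a_gt0 : 0 < `|a| by rewrite normr_gt0.
have If' : mu.-integrable setT (fun x => (f (a * x + b))%:E).
  apply/integrableP; split => //.
  have /integrableP[_] := If.
  rewrite (@ge0_integral_affine a b)//; last exact: measurableT_comp.
  rewrite /= => h.
  rewrite ltey; apply/eqP => e; move: h.
  by rewrite e gt0_muley ?lte_fin.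
split=> //.
rewrite /Rintegral [in LHS]integralE.
rewrite (@ge0_integral_affine a b ((EFin \o f)^\+)%E)//; last exact: measurable_funepos.
rewrite (@ge0_integral_affine a b ((EFin \o f)^\-)%E)//; last exact: measurable_funeneg.
rewrite [in RHS]integralE.
have E1 : (fun x => ((EFin \o f)^\+)%E (a * x + b)%R) = ((fun x => (f (a * x + b))%:E)^\+)%E.
  by apply/funext => x; rewrite funepos.unlock.
have E2 : (fun x => ((EFin \o f)^\-)%E (a * x + b)%R) = ((fun x => (f (a * x + b))%:E)^\-)%E.
  by apply/funext => x; rewrite funeneg.unlock.
rewrite E1 E2.
have F1 := integrable_pos_fin_num measurableT If'.
have F2 := integrable_neg_fin_num measurableT If'.
by rewrite -(fineK F1) -(fineK F2) -!EFinM -!EFinB -mulrBr.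
Qed.
End affine_line.

(** * Linear changes of variables in the iterated Lebesgue measure *)

Section rvec.
Context (R : realType).
(** An alias of ['rV[R]_n] carrying the sigma-algebra generated by the
coordinates. *)
Definition rvec n := 'rV[R]_n.
Definition rvec_display : measure_display. Proof. exact. Qed.
Definition coordinate n (i : 'I_n) (x : rvec n) : measurableTypeR R := x 0 i.
HB.instance Definition _ n := Pointed.on (rvec n).
Let Mrv n := @g_sigma_preimage _ (measurableTypeR R) (rvec n) n (@coordinate n).
Let M0 n : @Mrv n set0. Proof. exact: sigma_algebra0. Qed.
Let MC n A : @Mrv n A -> @Mrv n (~` A). Proof. exact: sigma_algebraC. Qed.
Let MU n (F : _^nat) : (forall i, @Mrv n (F i)) -> @Mrv n (\bigcup_i F i).
Proof. exact: sigma_algebra_bigcup. Qed.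
HB.instance Definition _ n := @isMeasurable.Build rvec_display (rvec n) (@Mrv n) (@M0 n) (@MC n) (@MU n).

Lemma measurable_coordinate n (i : 'I_n) : measurable_fun [set: rvec n] (coordinate i).
Proof.
move=> _ B mB; rewrite setTI; apply: sub_sigma_algebra.
rewrite -bigcup_seq/=; exists i => /=; first by rewrite mem_index_enum.
by exists B => //; rewrite setTI.
Qed.

Lemma measurable_fun_rvecP d (T : measurableType d) n (f : T -> rvec n) :
  (forall i, measurable_fun setT (fun x => coordinate i (f x))) -> measurable_fun setT f.
Proof.
move=> mf _ A mA; rewrite setTI.
have : (@g_sigma_preimage _ (measurableTypeR R) T n (fun i => @coordinate n i \o f)) `<=` measurable.
  apply: smallest_sub; first exact: sigma_algebra_measurable.
  rewrite -bigcup_seq/=.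
  by apply: bigcup_sub => i _ B [C mC <-]; exact: mf.
by apply; rewrite g_sigma_preimage_comp; exists A => //; rewrite setTI.
Qed.

Definition consv n (xy : measurableTypeR R * rvec n) : rvec n.+1 :=
  row_mx (const_mx xy.1 : 'rV_1) xy.2.

Definition unconsv n (z : rvec n.+1) : measurableTypeR R * rvec n :=
  (z 0 0, rsubmx (z : 'rV_(1 + n))).

Lemma consv0 n xy : @consv n xy 0 0 = xy.1.
Proof. by rewrite mxE; case: splitP => //= k _; rewrite mxE. Qed.

Lemma consvS n xy (j : 'I_n) : @consv n xy 0 (lift ord0 j) = xy.2 0 j.
Proof.
rewrite mxE; case: splitP => k /=; rewrite /bump /= add1n; first by case: k => -[].
by rewrite add1n => -[jk]; congr (xy.2 _ _); exact/val_inj.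
Qed.

Lemma unconsvS n z (j : 'I_n) : (unconsv z).2 0 j = z 0 (lift ord0 j).
Proof. by rewrite mxE; congr (z _ _); exact/val_inj. Qed.

Lemma consvK n : cancel (@consv n) (@unconsv n).
Proof.
move=> [x y]; apply: injective_projections => /=; first by rewrite consv0.
by apply/rowP => j; rewrite (unconsvS (consv (x, y))) consvS.
Qed.

Lemma measurable_consv n : measurable_fun setT (@consv n).
Proof.
apply: measurable_fun_rvecP => i; rewrite /coordinate.
case: (unliftP ord0 i) => [j ->|->].
  under eq_fun do rewrite consvS.
  by apply: (measurableT_comp (measurable_coordinate j)); exact: measurable_snd.
by under eq_fun do rewrite consv0; exact: measurable_fst.
Qed.

Lemma measurable_unconsv n : measurable_fun setT (@unconsv n).
Proof.
apply: measurable_fun_pair; first exact: (measurable_coordinate (0 : 'I_n.+1)).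
apply: measurable_fun_rvecP => i; rewrite /coordinate.
under eq_fun do rewrite mxE.
exact: (measurable_coordinate (rshift 1 i : 'I_n.+1)).
Qed.

Lemma measurable_consvr n (x : R) : measurable_fun setT (fun y => @consv n (x, y)).
Proof.
apply: (measurableT_comp (@measurable_consv n)); exact: measurable_fun_pair.
Qed.

Lemma measurable_consvl n (y : rvec n) :
  measurable_fun setT (fun x : measurableTypeR R => @consv n (x, y)).
Proof.
apply: (measurableT_comp (@measurable_consv n)); exact: measurable_fun_pair.
Qed.

Local Notation mu := (@lebesgue_measure R : set (measurableTypeR R) -> \bar R).

Section step.
Variables (n : nat) (m : {sigma_finite_measure set (rvec n) -> \bar R}).
Local Open Scope ereal_scope.

Definition cons_measure : set (rvec n.+1) -> \bar R :=
  pushforward (@lebesgue_measure R \x m) (@consv n).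

HB.instance Definition _ := Measure.copy cons_measure
  (@measure_function_pushforward__canonical__measure_function_Measure _ _ _ _ _
  (@lebesgue_measure R \x m) (@consv n) (@measurable_consv n)).

Let cons_sigma_finite : sigma_finite setT cons_measure.
Proof.
have /sigma_finiteP[F [FT ndF Foo]] := sigma_finiteT (@lebesgue_measure R).
have /sigma_finiteP[G [GT ndG Goo]] := sigma_finiteT m.
exists (fun k => @unconsv n @^-1` (F k `*` G k)).
  apply/esym/seteqP; split=> // z _.
  have [i _ Fi] : (\bigcup_i F i) (unconsv z).1 by rewrite -FT.
  have [j _ Gj] : (\bigcup_i G i) (unconsv z).2 by rewrite -GT.
  exists (maxn i j) => //; split.
    by move: Fi; exact/subsetPset/ndF/leq_maxl.
  by move: Gj; exact/subsetPset/ndG/leq_maxr.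
move=> k; have [mF Fk] := Foo k; have [mG Gk] := Goo k; split.
  by rewrite -[X in measurable X]setTI; apply: measurable_unconsv => //; exact: measurableX.
rewrite /cons_measure /pushforward (_ : _ @^-1` _ = F k `*` G k).
  by rewrite product_measure1E// lte_mul_pinfty// ge0_fin_numE.
by rewrite -comp_preimage (_ : _ \o _ = id)//; apply/funext => x; exact: consvK.
Qed.

HB.instance Definition _ := Measure_isSigmaFinite.Build _ _ _ cons_measure cons_sigma_finite.
End step.

(** This coincides with [lebesgue_rv] on every set ([vol_lebesgue_rv]), but is
packaged with its structure of sigma-finite measure, on which the theorems on
product measures rest. *)
Fixpoint vol n : {sigma_finite_measure set (rvec n) -> \bar R} :=
  match n with
  | 0 => dirac (0 : rvec 0)
  | k.+1 => cons_measure (vol k)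
  end.

Lemma vol_lebesgue_rv n (A : set 'rV[R]_n) : vol n A = lebesgue_rv A.
Proof.
elim: n A => [|n IH] A; first by [].
rewrite [LHS]/(cons_measure _ _) /pushforward /product_measure1 /=.
apply: eq_integral => x _; rewrite /= IH; congr (lebesgue_rv _).
by apply/seteqP; split => y; rewrite /xsection/= inE.
Qed.

Lemma vol_consE n (A : set (rvec n.+1)) :
  vol n.+1 A = (\int[mu]_x vol n [set y | A (consv (x, y))])%E.
Proof.
apply: eq_integral => x _; rewrite /=; congr (vol n _).
by apply/seteqP; split => y; rewrite /xsection/= inE.
Qed.

Lemma measurable_vol_section n (A : set (rvec n.+1)) : measurable A ->
  measurable_fun setT (fun x : measurableTypeR R => vol n [set y | A (consv (x, y))]).
Proof.
move=> mA.
have mA' : measurable (@consv n @^-1` A).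
  by rewrite -[X in measurable X]setTI; exact: measurable_consv.
have := measurable_fun_xsection (vol n) mA'.
congr (measurable_fun _ _); apply/funext => x /=; congr (vol n _).
by apply/seteqP; split => y; rewrite /xsection/= inE.
Qed.

Lemma measurable_mu_section n (A : set (rvec n.+1)) : measurable A ->
  measurable_fun setT (fun y : rvec n => mu [set x | A (consv (x, y))]).
Proof.
move=> mA.
have mA' : measurable (@consv n @^-1` A).
  by rewrite -[X in measurable X]setTI; exact: measurable_consv.
have := measurable_fun_ysection (@lebesgue_measure R) mA'.
congr (measurable_fun _ _); apply/funext => y /=; congr (mu _).
by apply/seteqP; split => x; rewrite /ysection/= inE.
Qed.

(** Tonelli, with the first coordinate integrated innermost. *)
Lemma vol_consE_swap n (A : set (rvec n.+1)) : measurable A ->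
  vol n.+1 A = (\int[vol n]_y mu [set x | A (consv (x, y))])%E.
Proof.
move=> mA.
have mA' : measurable (@consv n @^-1` A).
  by rewrite -[X in measurable X]setTI; exact: measurable_consv.
rewrite vol_consE.
transitivity (\int[mu]_x (vol n \o xsection (@consv n @^-1` A)) x)%E.
  apply: eq_integral => x _; rewrite /=; congr (vol n _).
  by apply/seteqP; split => y; rewrite /xsection/= inE.
transitivity (\int[vol n]_y (mu \o ysection (@consv n @^-1` A)) y)%E.
  have := indic_fubini_tonelli (@lebesgue_measure R) (vol n) mA'.
  have h1 := @indic_fubini_tonelli_FE _ _ _ _ _ (vol n) _ mA'.
  have h2 := @indic_fubini_tonelli_GE _ _ _ _ _ (@lebesgue_measure R) _ mA'.
  move=> h.
  apply: (etrans (f_equal (fun G => \int[mu]_y G y)%E (esym h1))).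
  exact: (etrans h (f_equal (fun G => \int[vol n]_y G y)%E h2)).
apply: eq_integral => x _; rewrite /=; congr (mu _).
by apply/seteqP; split => y; rewrite /ysection/= inE.
Qed.

Lemma measurable_row_mul n (M : 'M[R]_n) : measurable_fun setT (fun y : rvec n => y *m M : rvec n).
Proof.
apply: measurable_fun_rvecP => i; rewrite /coordinate.
under eq_fun do rewrite mxE.
apply: measurable_sum => j; apply: measurable_funM => //.
exact: measurable_coordinate.
Qed.

Lemma measurable_row_add n (v : 'rV[R]_n) : measurable_fun setT (fun y : rvec n => v + y : rvec n).
Proof.
apply: measurable_fun_rvecP => i; rewrite /coordinate.
under eq_fun do rewrite mxE.
apply: measurable_funD => //; exact: measurable_coordinate.
Qed.

Lemma measurable_preim d d' (T : measurableType d) (U : measurableType d') (f : T -> U) A :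
  measurable_fun setT f -> measurable A -> measurable [set x | A (f x)].
Proof. by move=> mf mA; rewrite -[X in measurable X]setTI; exact: mf. Qed.

Definition rectangle n (D : 'I_n -> set R) : set (rvec n) := [set z | forall i, D i (z 0 i)].

Lemma measurable_rectangle n (D : 'I_n -> set R) : (forall i, measurable (D i)) ->
  measurable (rectangle D).
Proof.
move=> mD.
rewrite (_ : rectangle _ = \bigcap_(i in [set: 'I_n]) [set z | D i (coordinate i z)]).
  apply: fin_bigcap_measurable => // i _.
  by apply: measurable_preim (mD _); exact: measurable_coordinate.
by apply/seteqP; split => z h i; [move=> _; exact: h|exact: h i I].
Qed.

Lemma vol_rectangle n (D : 'I_n -> set R) : (forall i, measurable (D i)) ->
  vol n (rectangle D) = (\prod_(i < n) mu (D i))%E.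
Proof.
elim: n D => [|n IH] D mD.
  by rewrite big_ord0 /= diracE mem_set// => -[].
have mDS := measurable_rectangle (fun i => mD (lift ord0 i)).
rewrite big_ord_recl -IH// -product_measure1E//; last exact: (mD ord0).
rewrite [LHS]/(cons_measure _ _) /pushforward; congr product_measure1.
apply/seteqP; split => -[x y] /=.
  move=> h; split=> [|i] /=; first by have := h 0; rewrite consv0.
  by have := h (lift ord0 i); rewrite consvS.
case=> /= h1 h2 i; case: (unliftP ord0 i) => [j ->|->].
  by rewrite consvS; exact: h2.
by rewrite consv0.
Qed.

(** Both sides agree on rectangles, which are stable under intersection,
generate the sigma-algebra and include an exhaustion of the space by boxes of
finite measure. *)
Lemma vol_perm n (s : {perm 'I_n}) (A : set (rvec n)) : measurable A ->
  vol n A = vol n [set y | A (y *m perm_mx s)].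
Proof.
move=> mA.
pose m h : {measure set (rvec n) -> \bar R} :=
  @measure_function_pushforward__canonical__measure_function_Measure _ _ _ _ _ (vol n) (fun y : rvec n => y *m perm_mx s : rvec n) h.
pose G : set (set (rvec n)) := [set A | exists D : 'I_n -> set R, (forall i, measurable (D i)) /\ A = rectangle D].
pose g (k : nat) : set (rvec n) := rectangle (fun=> `[- k%:R, k%:R]%classic).
have permE (y : 'rV[R]_n) i : (y *m perm_mx s) 0 i = y 0 ((s^-1)%g i).
  by rewrite -{1}(invgK s) -col_permE mxE.
rewrite (measure_unique G g _ _ _ _ (vol n) (m (@measurable_row_mul n (perm_mx s))))//.
- rewrite eqEsubset; split.
    apply: smallest_sub; first exact: smallest_sigma_algebra.
    rewrite -bigcup_seq/=; apply: bigcup_sub => i _ _ [C mC <-].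
    apply: sub_sigma_algebra; exists (fun j => if j == i then C else setT); split.
      by move=> j; case: ifP.
    rewrite setTI; apply/seteqP; split => z /=.
      by move=> Cz j; case: ifP => // /eqP ->.
    by move=> /(_ i); rewrite eqxx.
  apply: smallest_sub; first exact: sigma_algebra_measurable.
  by move=> _ [D [mD ->]]; exact: measurable_rectangle.
- move=> _ _ [D [mD ->]] [E [mE ->]]; exists (fun i => D i `&` E i); split.
    by move=> i; exact: measurableI.
  apply/seteqP; split => z /= h; first by case: h => h1 h2 i; split.
  by split => i; case: (h i).
- by move=> k; exists (fun=> `[- k%:R, k%:R]%classic).
- rewrite -subTset => z _; exists (Num.bound (\sum_i `|z 0 i|)) => // i.
  have h : `|z 0 i| <= (Num.bound (\sum_i `|z 0 i|))%:R.
    apply: (@le_trans _ _ (\sum_i `|z 0 i|)).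
      by rewrite (bigD1 i)//= lerDl sumr_ge0.
    by apply/ltW/archi_boundP; rewrite sumr_ge0.
  by rewrite /= in_itv/= -ler_norml.
- move=> _ [D [mD ->]].
  transitivity (vol n (rectangle (fun i => D (s i)))).
    apply: (etrans (vol_rectangle mD)); rewrite (reindex_inj (@perm_inj _ s)).
    by rewrite vol_rectangle.
  rewrite /m /= /pushforward; congr (vol n _); apply/seteqP; split => z /= h i.
    by rewrite permE; have := h ((s^-1)%g i); rewrite permKV.
  by have := h (s i); rewrite permE permK.
- move=> k; rewrite (_ : (_ < _)%E = (vol n (g k) < +oo)%E)// vol_rectangle//.
  have : (\prod_(i < n) mu `[(- k%:R)%R, k%:R]%classic)%E \is a fin_num.
    elim/big_ind : _ => // [x y|i _]; first exact: fin_numM.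
    by rewrite /= lebesgue_measure_itv; case: ifP.
  by move=> /fin_numPlt/andP[].
Qed.

Lemma add_consv n (v : rvec n.+1) x y :
  (v + consv (x, y) : 'rV_n.+1) = consv (v 0 0 + x, (unconsv v).2 + y : 'rV_n).
Proof.
apply/rowP => i; rewrite [LHS]mxE; case: (unliftP ord0 i) => [j ->|->].
  by rewrite !consvS [RHS]mxE unconsvS.
by rewrite !consv0.
Qed.

Lemma vol_row_add n (v : 'rV[R]_n) (A : set (rvec n)) : measurable A ->
  vol n A = vol n [set y | A (v + y)].
Proof.
elim: n v A => [|n IH] v A mA.
  have e (y : 'rV[R]_0) : v + y = y by rewrite (thinmx0 (v + y)) (thinmx0 y).
  by congr (vol 0 _); apply/seteqP; split => y; rewrite /= e.
pose f (x : R) := vol n [set y | A (consv (x, y))].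
have mAx (x : R) : measurable [set y | A (consv (x, y))].
  by apply: measurable_preim (@measurable_consvr n x) mA.
rewrite !vol_consE -/f.
rewrite (@ge0_integral_affine _ 1 (v 0 0) f)//; last exact: measurable_vol_section.
rewrite normr1 mul1e; apply: eq_integral => x _; rewrite /f.
rewrite (IH (unconsv v).2 _ (mAx _)).
by congr (vol n _); apply/seteqP; split => y /=; rewrite add_consv mul1r addrC.
Qed.

(** The change of variables formula for [y |-> y *m M]: a property that passes
to products, and so can be checked on the factors of an LUP decomposition. *)
Definition scales_vol n (M : 'M[R]_n) := forall A : set (rvec n), measurable A ->
  vol n A = (`|\det M|%:E * vol n [set y | A (y *m M)])%E.

Lemma scales_vol_mul n (M N : 'M[R]_n) : scales_vol M -> scales_vol N -> scales_vol (M *m N).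
Proof.
move=> hM hN A mA; rewrite (hN A mA) hM; last first.
  by apply: measurable_preim mA; exact: measurable_row_mul.
rewrite muleA -EFinM -normrM mulrC det_mulmx; congr (_ * vol n _)%E.
by apply/seteqP; split => y /=; rewrite mulmxA.
Qed.

Lemma scales_vol_perm n (s : {perm 'I_n}) : scales_vol (perm_mx s : 'M[R]_n).
Proof.
move=> A mA; rewrite det_perm normrX normrN1 expr1n mul1e; exact: vol_perm.
Qed.

Lemma consv_mul_block n x y (a : R) (b : 'rV[R]_n) (c : 'cV[R]_n) (D : 'M[R]_n) :
  (consv (x, y) : 'rV_(1 + n)) *m block_mx a%:M b c D =
  consv (x * a + (y *m c) 0 0, x *: b + y *m D).
Proof.
rewrite /consv /= mul_row_block; congr row_mx.
  by rewrite mul_mx_scalar; apply/rowP => i; rewrite !mxE (ord1 i) mulrC.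
by congr (_ + _); apply/rowP => i; rewrite !mxE big_ord1 !mxE.
Qed.

(** On each section along the first coordinate the map is [D] up to a
translation. *)
Lemma scales_vol_upper_block n (a : R) (b : 'rV[R]_n) (D : 'M[R]_n) :
  a != 0 -> scales_vol D -> scales_vol (block_mx a%:M b 0 D : 'M[R]_(1 + n)).
Proof.
move=> a0 hD A mA.
pose f (x : R) := vol n [set y | A (consv (x, y))].
have mAx (x : R) : measurable [set y | A (consv (x, y))].
  by apply: measurable_preim (@measurable_consvr n x) mA.
rewrite det_ublock det_scalar expr1 normrM EFinM.
rewrite !vol_consE -/f.
rewrite (@ge0_integral_affine _ a 0 f)//; last exact: measurable_vol_section.
rewrite -muleA; congr (_ * _)%E.
rewrite -ge0_integralZl//; last first.
  apply: measurable_vol_section.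
  by apply: measurable_preim mA; exact: measurable_row_mul.
apply: eq_integral => x _; rewrite /f addr0 (vol_row_add (x *: b) (mAx _)) hD; last first.
  by apply: measurable_preim (mAx _); exact: measurable_row_add.
congr (_ * vol n _)%E; apply/seteqP; split => y /=;
  by rewrite consv_mul_block mulmx0 mxE addr0 mulrC.
Qed.

(** Here the other coordinates shift the first one, so that once [D] has been
undone on the other coordinates the first is integrated innermost, where the
map is affine on the line. *)
Lemma scales_vol_lower_block n (a : R) (c : 'cV[R]_n) (D : 'M[R]_n) :
  a != 0 -> scales_vol D -> scales_vol (block_mx a%:M 0 c D : 'M[R]_(1 + n)).
Proof.
move=> a0 hD A mA.
rewrite det_lblock det_scalar expr1 normrM EFinM.
set M := block_mx _ _ _ _.
have mAM : measurable [set y : rvec n.+1 | A (y *m M)].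
  exact: (measurable_preim (@measurable_row_mul n.+1 M) mA).
rewrite (vol_consE_swap mAM).
(* the preimage of [A] under the part of the map that acts as [D] *)
pose B : set (rvec n.+1) := [set z | A (consv ((unconsv z).1, (unconsv z).2 *m D))].
have mB : measurable B.
  apply: measurable_preim mA; apply: (measurableT_comp (@measurable_consv n)).
  apply: measurable_fun_pair.
    by apply: (measurableT_comp measurable_fst); exact: measurable_unconsv.
  apply: (measurableT_comp (@measurable_row_mul _ D)).
  by apply: (measurableT_comp measurable_snd); exact: measurable_unconsv.
have mAy (y : rvec n) : measurable [set x : measurableTypeR R | A (consv (x, y))].
  by apply: measurable_preim (@measurable_consvl n y) mA.
have BE x y : B (consv (x, y)) = A (consv (x, y *m D)).
  by rewrite /B -[LHS]/(A (consv ((unconsv (consv (x, y))).1, (unconsv (consv (x, y))).2 *m D))) consvK.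
transitivity (`|\det D|%:E * vol n.+1 B)%E.
  rewrite !vol_consE -ge0_integralZl//; last exact: measurable_vol_section.
  apply: eq_integral => x _; rewrite hD.
    by congr (_ * vol n _)%E; apply/seteqP; split => y /=; rewrite BE.
  by apply: measurable_preim (@measurable_consvr n x) mA.
rewrite muleC vol_consE_swap// [RHS]muleC muleA; congr (_ * _)%E.
rewrite muleC -ge0_integralZl//; last exact: measurable_mu_section.
apply: eq_integral => y _.
rewrite (@lebesgue_measure_affine _ a ((y *m c) 0 0))//; last first.
  exact: (measurable_preim (@measurable_consvl n y) mB).
congr (_ * mu _)%E.
apply/seteqP; split => x /=; rewrite BE consv_mul_block /=.
  by rewrite scaler0 add0r mulrC.
by rewrite scaler0 add0r mulrC.
Qed.

Lemma scales_vol_upper n (U : 'M[R]_n) : (forall i j : 'I_n, (j < i)%N -> U i j = 0) ->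
  (forall i, U i i != 0) -> scales_vol U.
Proof.
elim: n U => [|n IH] U U0 Ud.
  move=> A mA; rewrite det_mx00 normr1 mul1e; congr (vol 0 _).
  have e (y : 'rV[R]_0) : y *m U = y by rewrite (thinmx0 (y *m U)) (thinmx0 y).
  by apply/seteqP; split => y; rewrite /= e.
have -> : U = block_mx (U 0 0)%:M (ursubmx (U : 'M[R]_(1 + n))) 0 (drsubmx (U : 'M[R]_(1 + n))).
  have e1 : ulsubmx (U : 'M[R]_(1 + n)) = (U 0 0)%:M.
    by apply/matrixP => i j; rewrite !mxE !ord1 mulr1n; congr (U _ _); exact/val_inj.
  have e2 : dlsubmx (U : 'M[R]_(1 + n)) = 0.
    by apply/matrixP => i j; rewrite !mxE U0//= (ord1 j).
  by rewrite -[LHS](@submxK _ 1 n 1 n) e1 e2.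
apply: scales_vol_upper_block; first exact: Ud.
apply: IH => [i j ij|i]; rewrite !mxE; last exact: Ud.
by apply: U0; rewrite /= ltn_add2l.
Qed.

Lemma scales_vol_lower n (L : 'M[R]_n) : (forall i j : 'I_n, (i < j)%N -> L i j = 0) ->
  (forall i, L i i != 0) -> scales_vol L.
Proof.
elim: n L => [|n IH] L L0 Ld.
  move=> A mA; rewrite det_mx00 normr1 mul1e; congr (vol 0 _).
  have e (y : 'rV[R]_0) : y *m L = y by rewrite (thinmx0 (y *m L)) (thinmx0 y).
  by apply/seteqP; split => y; rewrite /= e.
have -> : L = block_mx (L 0 0)%:M 0 (dlsubmx (L : 'M[R]_(1 + n))) (drsubmx (L : 'M[R]_(1 + n))).
  have e1 : ulsubmx (L : 'M[R]_(1 + n)) = (L 0 0)%:M.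
    by apply/matrixP => i j; rewrite !mxE !ord1 mulr1n; congr (L _ _); exact/val_inj.
  have e2 : ursubmx (L : 'M[R]_(1 + n)) = 0.
    by apply/matrixP => i j; rewrite !mxE L0//= (ord1 i).
  by rewrite -[LHS](@submxK _ 1 n 1 n) e1 e2.
apply: scales_vol_lower_block; first exact: Ld.
apply: IH => [i j ij|i]; rewrite !mxE; last exact: Ld.
by apply: L0; rewrite /= ltn_add2l.
Qed.

(** The permutation and triangular factors of [M] all satisfy the formula. *)
Lemma unitmx_scales_vol n (M : 'M[R]_n) : M \in unitmx -> scales_vol M.
Proof.
case: n M => [|n] M Mu; first by apply: scales_vol_upper => -[].
have := cormen_lup_correct M; have := cormen_lup_perm M.
have := cormen_lup_lower M; have := cormen_lup_upper M; have := cormen_lup_detL M.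
case: cormen_lup => [[P L] U] /= detL hU hL /is_perm_mxP[s ->] PM.
have -> : M = perm_mx (s^-1)%g *m (L *m U).
  by rewrite -[L *m U]PM mulmxA -perm_mxM mulVg perm_mx1 mul1mx.
apply: scales_vol_mul; first exact: scales_vol_perm.
apply: scales_vol_mul.
  apply: scales_vol_lower => [i j ij|i]; rewrite hL ?(ltnW ij)// ?leqnn ?eqxx ?oner_neq0//.
  by rewrite (_ : (i == j) = false)// -val_eqE /= ltn_eqF.
apply: scales_vol_upper => // i; apply/eqP => Uii.
have : \det U = 0.
  rewrite -det_tr det_trig.
    by apply/eqP/prodf_eq0; exists i => //; rewrite mxE Uii.
  by apply/is_trig_mxP => k l kl; rewrite mxE hU.
have : \det (perm_mx s *m M) != 0.
  by rewrite det_mulmx mulf_neq0// -unitfE -unitmxE// unitmx_perm.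
rewrite [_ *m _]PM => + h.
by rewrite -[L * U]/(L *m U) det_mulmx h mulr0 eqxx.
Qed.

Lemma lebesgue_rv_affine n (M : 'M[R]_n) v (A : set (rvec n)) : M \in unitmx -> measurable A ->
  (lebesgue_rv A = `|\det M|%:E * lebesgue_rv [set y : 'rV_n | A (v + y *m M)%R])%E.
Proof.
move=> Mu mA; rewrite -!vol_lebesgue_rv (vol_row_add v mA).
rewrite (unitmx_scales_vol Mu)//.
by apply: measurable_preim mA; exact: measurable_row_add.
Qed.

End rvec.

(** * Distance to a hyperplane *)

Section dot.
Context {R : realType}.

Lemma dotrvE n (u v : 'rV[R]_n) : dotrv u v = \sum_i u 0 i * v 0 i.
Proof. by rewrite /dotrv mxE; apply: eq_bigr => i _; rewrite mxE. Qed.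

Lemma dotrvDl n (u v w : 'rV[R]_n) : dotrv (u + v) w = dotrv u w + dotrv v w.
Proof. by rewrite /dotrv mulmxDl mxE. Qed.

Lemma dotrvBl n (u v w : 'rV[R]_n) : dotrv (u - v) w = dotrv u w - dotrv v w.
Proof. by rewrite /dotrv mulmxBl !mxE. Qed.

Lemma dotrvZl n a (u w : 'rV[R]_n) : dotrv (a *: u) w = a * dotrv u w.
Proof. by rewrite /dotrv -scalemxAl mxE. Qed.

Lemma dotrvC n (u v : 'rV[R]_n) : dotrv u v = dotrv v u.
Proof. by rewrite !dotrvE; apply: eq_bigr => i _; rewrite mulrC. Qed.

Lemma dotrv_ge0 n (u : 'rV[R]_n) : 0 <= dotrv u u.
Proof. by rewrite dotrvE sumr_ge0// => i _; rewrite -expr2 sqr_ge0. Qed.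

Lemma mulmx_trE n (u v : 'rV[R]_n) : u *m v^T = (dotrv u v)%:M.
Proof. by rewrite [LHS]mx11_scalar. Qed.

(** Cauchy-Schwarz, from the squared norm of the component of [u] orthogonal
to [w]. *)
Lemma dotrv_sqr_le n (u w : 'rV[R]_n) : dotrv u w ^+ 2 <= dotrv u u * dotrv w w.
Proof.
have [w0|w0] := eqVneq (dotrv w w) 0.
  have : dotrv u w = 0.
    rewrite dotrvE big1// => i _.
    have : w 0 i * w 0 i = 0.
      move: w0; rewrite dotrvE => /eqP; rewrite psumr_eq0; last by move=> j _; rewrite -expr2 sqr_ge0.
      by move=> /allP/(_ i); rewrite mem_index_enum => /(_ isT)/eqP.
    by move=> /eqP; rewrite mulf_eq0 orbb => /eqP ->; rewrite mulr0.
  by move=> ->; rewrite w0 mulr0 expr0n.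
have w_gt0 : 0 < dotrv w w by rewrite lt_neqAle eq_sym w0 dotrv_ge0.
have := dotrv_ge0 (u - (dotrv u w / dotrv w w) *: w).
rewrite dotrvBl dotrvZl !(dotrvC _ (u - _)) !dotrvBl !dotrvZl (dotrvC w u) => h.
have : 0 <= dotrv w w * (dotrv u u - dotrv u w / dotrv w w * dotrv u w -
    dotrv u w / dotrv w w * (dotrv u w - dotrv u w / dotrv w w * dotrv w w)).
  by rewrite mulr_ge0// ltW.
by rewrite (_ : _ * _ = dotrv u u * dotrv w w - dotrv u w ^+ 2); [rewrite subr_ge0|field].
Qed.

End dot.

Section hyperplane_distance.
Context {R : realType}.

(** Cauchy-Schwarz bounds the distance below, and the orthogonal projection of
[x] attains the bound. *)
Lemma eucl_dist_hyperplane n (x p w : 'rV[R]_n) : 0 < dotrv w w ->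
  eucl_dist x (hyperplane p w) = `|dotrv (p - x) w| / eucl_norm w.
Proof.
move=> w0; rewrite /eucl_dist.
set c := dotrv (p - x) w.
have nw : 0 < eucl_norm w by rewrite /eucl_norm sqrtr_gt0.
have nw2 : eucl_norm w ^+ 2 = dotrv w w by rewrite /eucl_norm sqr_sqrtr// ltW.
set E := [set _ | _ in _].
have lbE : lbound E (`|c| / eucl_norm w).
  move=> _ [y hy <-]; rewrite ler_pdivrMr// -sqrtr_sqr /eucl_norm -sqrtrM ?dotrv_ge0//.
  rewrite ler_wsqrtr//.
  have -> : c = dotrv (y - x) w.
    by move: hy; rewrite /hyperplane /= /c !dotrvBl => h; lra.
  exact: dotrv_sqr_le.
have inE' : E (`|c| / eucl_norm w).
  exists (x + (c / dotrv w w) *: w).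
    rewrite /hyperplane /= dotrvBl dotrvDl dotrvZl mulfVK ?gt_eqF//.
    by rewrite /c dotrvBl; ring.
  rewrite [x + _]addrC addrK /eucl_norm dotrvZl dotrvC dotrvZl mulfVK ?gt_eqF//.
  rewrite -[c / _ * c]/(c / dotrv w w * c) mulrAC -expr2 sqrtrM ?sqr_ge0// sqrtr_sqr.
  by rewrite sqrtrV// ltW.
apply/eqP; rewrite eq_le; apply/andP; split.
  by apply: ge_inf => //; exists (`|c| / eucl_norm w).
by apply: lb_le_inf => //; exists (`|c| / eucl_norm w).
Qed.

End hyperplane_distance.

(** * Orthonormal bases of a hyperplane direction *)

Section orthonormal_rows.
Context {R : realType}.

(** Completing [B] by the row [u] gives an orthogonal matrix, whose adjugate is
its transpose up to the sign of its determinant; compare the entries at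
[(0, 0)].  Geometrically, projecting the hyperplane orthogonal to [u] along the
first axis shrinks volumes by the cosine [u 0 0]. *)
Lemma norm_det_rsubmx n (u : 'rV[R]_(1 + n)) (B : 'M[R]_(n, 1 + n)) :
  dotrv u u = 1 -> u *m B^T = 0 -> B *m B^T = 1%:M ->
  `|\det (rsubmx B)| = `|u 0 0|.
Proof.
move=> uu uB BB.
pose M : 'M[R]_(1 + n) := col_mx u B.
have MM : M *m M^T = 1%:M.
  rewrite /M tr_col_mx mul_col_row mulmx_trE uu uB BB.
  have -> : B *m u^T = 0 by apply: trmx_inj; rewrite trmx_mul trmxK uB trmx0.
  by rewrite -scalar_mx_block.
have dM : `|\det M| = 1.
  have : \det M ^+ 2 = 1 by rewrite expr2 -{2}(det_tr M) -det_mulmx MM det1.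
  by move=> h; apply/eqP; rewrite -(@pexpr_eq1 _ _ 2)// -normrX h normr1.
have adjM : \adj M = \det M *: M^T.
  rewrite -[LHS]mul1mx -(mulmx1C MM) -mulmxA mul_mx_adj mul_mx_scalar.
  by [].
have : (\adj M) 0 0 = \det M * u 0 0.
  rewrite adjM [LHS]mxE [X in _ * X]mxE /M mxE; case: splitP => // j _.
  by rewrite (ord1 j).
rewrite !mxE /cofactor addn0 expr0 mul1r.
have -> : row' 0 (col' 0 M) = rsubmx B.
  apply/matrixP => i j; rewrite [LHS]mxE [LHS]mxE [RHS]mxE /M [LHS]mxE.
  case: splitP => k /=; first by case: k => -[].
  by rewrite /bump /= add1n => -[/val_inj ->]; congr (B _ _); exact/val_inj.
by move=> ->; rewrite normrM dM mul1r.
Qed.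

(** Take all the rows but the first of the Householder reflection that
exchanges [u] and the first basis vector. *)
Lemma exists_orthonormal_rows n (u : 'rV[R]_(1 + n)) : dotrv u u = 1 -> u 0 0 != 1 ->
  exists B : 'M[R]_(n, 1 + n), [/\ u *m B^T = 0, B *m B^T = 1%:M & u^T *m u + B^T *m B = 1%:M].
Proof.
move=> uu u0.
pose e : 'rV[R]_(1 + n) := delta_mx 0 0.
have [v vE] : exists v, v = u - e by exists (u - e).
pose k := 1 - u 0 0.
have k0 : k != 0 by rewrite subr_eq0 eq_sym.
(* the reflection along [u - e]; the squared norm of [u - e] is [2 * k], which
   vanishes if [u = e] *)
pose Q : 'M[R]_(1 + n) := 1%:M - k^-1 *: (v^T *m v).
have ee : dotrv e e = 1.
  rewrite dotrvE (bigD1 0)//= big1 ?addr0 => [|i i0]; rewrite !mxE ?eqxx ?mulr1//.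
  by rewrite (negbTE i0) andbF mulr0.
have ue : dotrv u e = u 0 0.
  rewrite dotrvE (bigD1 0)//= big1 ?addr0 => [|i i0]; rewrite !mxE ?eqxx ?mulr1//.
  by rewrite (negbTE i0) andbF mulr0.
have vv : dotrv v v = 2 * k.
  by rewrite vE dotrvBl !(dotrvC _ (u - e)) !dotrvBl uu ee (dotrvC e u) ue /k; ring.
have Qt : Q^T = Q by rewrite /Q linearB /= trmx1 linearZ /= trmx_mul trmxK.
have QQ : Q *m Q = 1%:M.
  rewrite /Q mulmxBl mul1mx mulmxBr mulmx1 -scalemxAl -scalemxAr scalerA.
  rewrite -(mulmxA v^T) (mulmxA v) mulmx_trE vv mul_scalar_mx -scalemxAr scalerA.
  rewrite (_ : _ * (2 * k) = 2 * k^-1); last by field.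
  by rewrite -[(2 / k) *: _]scalerA scaler_nat mulr2n opprB addrK subrK.
have eQ : e *m Q = u.
  rewrite /Q mulmxBr mulmx1 -scalemxAr mulmxA mulmx_trE mul_scalar_mx scalerA.
  have -> : dotrv e v = - k.
    by rewrite dotrvC vE dotrvBl ue ee /k; ring.
  by rewrite mulrN mulVf// scaleN1r opprK vE addrC subrK.
clearbody Q.
have QE : Q = col_mx u (dsubmx Q).
  rewrite -[LHS](@vsubmxK _ 1 n); congr col_mx.
  rewrite -eQ /e -rowE; apply/rowP => i.
  by rewrite [LHS]mxE [RHS]mxE; congr (Q _ _); exact/val_inj.
pose B := dsubmx Q; exists B.
have h : Q *m Q^T = 1%:M by rewrite Qt.
rewrite {1 2}QE tr_col_mx mul_col_row scalar_mx_block in h.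
have [_ h1 _ h2] := eq_block_mx h.
have : Q^T *m Q = 1%:M by rewrite Qt.
rewrite {1 2}QE tr_col_mx mul_row_col => h3.
by split.
Qed.

End orthonormal_rows.

(** * Diagonal sections as slabs of a lower-dimensional cube *)

Section sections_of_the_cube.
Context {R : realType}.

(** What remains of a diagonal section when its first coordinate [x] is
forgotten: the last inequality says that [x], which the hyperplane determines,
lies in [[0, 1]]. *)
Definition slab n (e : 'I_n -> R) (c : R) : set (rvec R n) :=
  [set z | (forall i, 0 <= z 0 i <= 1) /\
    `|c - \sum_i e i * (z 0 i - 2^-1)| <= 2^-1].

Lemma measurable_slab n (e : 'I_n -> R) c : measurable (slab e c).
Proof.
have -> : slab e c = rectangle (fun=> `[0, 1]%classic) `&`
    [set z | `[-2^-1, 2^-1]%classic (c - \sum_i e i * (coordinate i z - 2^-1))].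
  apply/seteqP; split => z [] h1 h2; split.
  - by move=> i; rewrite /= in_itv/=; exact: h1.
  - by rewrite /= in_itv/= -ler_norml.
  - by move=> i; have := h1 i; rewrite /= in_itv/=.
  - by move: h2; rewrite /= in_itv/= -ler_norml.
apply: measurableI; first exact: measurable_rectangle.
have mf : measurable_fun setT (fun z : rvec R n =>
    c - \sum_i e i * (coordinate i z - 2^-1) : measurableTypeR R).
  apply: measurable_funB => //; apply: measurable_sum => i.
  apply: measurable_funM => //; apply: measurable_funB => //.
  exact: measurable_coordinate.
exact: (measurable_preim mf (measurable_itv _)).
Qed.

Section chart.
Variables (n : nat) (a p : 'rV[R]_n.+1).
Hypothesis va : is_vertex a.
Local Notation w := (opposite_vertex a - a).
Local Notation o := (@hypercube_center R n.+1).
Let d : R := n.+1%:R.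

Lemma normal_entry i : w 0 i = 1 \/ w 0 i = -1.
Proof. by rewrite !mxE; case: (va i) => ->; [left|right]; lra. Qed.

Lemma normal_sqr i : w 0 i * w 0 i = 1.
Proof. by case: (normal_entry i) => ->; rewrite ?mulrNN mulr1. Qed.

Lemma dotrv_normal : dotrv w w = d.
Proof.
rewrite dotrvE (eq_bigr (fun=> 1)) ?sumr_const ?card_ord// => i _.
exact: normal_sqr.
Qed.

Lemma d_gt0 : 0 < d. Proof. exact: ltr0Sn. Qed.

Lemma sqrtd_gt0 : 0 < Num.sqrt d. Proof. by rewrite sqrtr_gt0 d_gt0. Qed.

Lemma sqrtd_sqr : Num.sqrt d * Num.sqrt d = d.
Proof. by rewrite -expr2 sqr_sqrtr// ltW// d_gt0. Qed.

Lemma hypercube_slab (x : 'rV[R]_(1 + n)) : hyperplane p w x ->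
  @hypercube R n.+1 x <->
  slab (fun i => w 0 (lift ord0 i)) (dotrv (p - o) w) (rsubmx x : 'rV_n).
Proof.
move=> hx.
have xS i : (rsubmx x : 'rV_n) 0 i = x 0 (lift ord0 i).
  by rewrite mxE; congr (x _ _); exact/val_inj.
have -> : dotrv (p - o) w = \sum_i (x 0 i - 2^-1) * w 0 i.
  move: hx; rewrite /hyperplane /= !dotrvBl => /eqP; rewrite subr_eq0 => /eqP <-.
  by rewrite -dotrvBl dotrvE; apply: eq_bigr => i _; rewrite [X in X * _]mxE [X in _ + X]mxE [in X in _ + X]mxE.
rewrite big_ord_recl /slab /=.
have -> : (x 0 ord0 - 2^-1) * w 0 ord0 +
    \sum_(i < n) (x 0 (lift ord0 i) - 2^-1) * w 0 (lift ord0 i) -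
    \sum_i w 0 (lift ord0 i) * ((rsubmx x : 'rV_n) 0 i - 2^-1) = (x 0 ord0 - 2^-1) * w 0 ord0.
  rewrite (eq_bigr (fun i => w 0 (lift ord0 i) * ((rsubmx x : 'rV_n) 0 i - 2^-1))).
    by rewrite addrK.
  by move=> i _; rewrite mulrC xS.
have -> : (`|(x 0 ord0 - 2^-1) * w 0 ord0| <= 2^-1) = (0 <= x 0 ord0 <= 1).
  rewrite normrM (_ : `|w 0 ord0| = 1) ?mulr1.
    by rewrite ler_norml; apply/andP/andP => -[]; split; lra.
  by case: (normal_entry ord0) => ->; rewrite ?normrN normr1.
split=> [h|[h1 h2] i]; first by split => [i|]; rewrite ?xS; exact: h.
by case: (unliftP ord0 i) => [j ->|->//]; have := h1 j; rewrite xS.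
Qed.

Let e i := w 0 (lift ord0 i).

(** A chart followed by the projection that forgets the first coordinate is an
affine map onto the slab, with Jacobian [1 / sqrt d] by [norm_det_rsubmx]. *)
Lemma chart_volume (q : 'rV[R]_n.+1) (B : 'M[R]_(n.+1.-1, n.+1)) :
  isometric_chart (hyperplane p w) q B ->
  (lebesgue_rv [set y : 'rV[R]_n.+1.-1 | (hyperplane p w `&` @hypercube R n.+1) (q + y *m B)%R] =
  (Num.sqrt d)%:E * lebesgue_rv (slab e (dotrv (p - o) w)))%E.
Proof.
move=> [BB rB].
have hyB (y : 'rV_n) : hyperplane p w (q + y *m B) by rewrite -rB; exists y.
have wB : w *m B^T = 0.
  apply: trmx_inj; rewrite trmx_mul trmxK trmx0; apply/row_matrixP => i.
  rewrite row_mul row0; apply/rowP => j; rewrite (ord1 j).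
  have := hyB (delta_mx 0 i); have := hyB 0.
  rewrite /hyperplane /= mul0mx addr0 -rowE !dotrvBl dotrvDl => h1 h2.
  by rewrite [RHS]mxE -/(dotrv (row i B) w); lra.
pose u : 'rV[R]_(1 + n) := (Num.sqrt d)^-1 *: w.
have uu : dotrv u u = 1.
  rewrite dotrvZl dotrvC dotrvZl dotrv_normal mulrA -invfM sqrtd_sqr mulVf//.
  by rewrite gt_eqF// d_gt0.
have uB : u *m (B : 'M[R]_(n, 1 + n))^T = 0 by rewrite -scalemxAl wB scaler0.
have detB := norm_det_rsubmx uu uB BB.
have u0 : `|u 0 0| = (Num.sqrt d)^-1.
  rewrite mxE normrM ger0_norm ?invr_ge0 ?sqrtr_ge0//.
  by case: (normal_entry 0) => ->; rewrite ?normrN normr1 mulr1.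
set M := rsubmx _ in detB.
have Mu : M \in unitmx.
  by rewrite unitmxE unitfE -normr_gt0 detB u0 invr_gt0 sqrtd_gt0.
rewrite (lebesgue_rv_affine (rsubmx (q : 'rV_(1 + n))) Mu (@measurable_slab _ _ _)).
rewrite detB u0 muleA -EFinM divff ?gt_eqF ?sqrtd_gt0// mul1e.
congr lebesgue_rv; apply/seteqP.
have eB (y : 'rV_n) : rsubmx (q : 'rV_(1 + n)) + y *m M = rsubmx (q + y *m B : 'rV_(1 + n)).
  apply/rowP => i; rewrite [LHS]mxE [X in X + _]mxE [RHS]mxE [RHS]mxE; congr (_ + _).
  by rewrite [LHS]mxE [RHS]mxE; apply: eq_bigr => k _; rewrite /M mxE.
split=> y /=.
  by move=> [h1 h2]; rewrite eB; exact: (hypercube_slab h1).1.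
by rewrite eB => h; split; [exact: hyB|exact: (hypercube_slab (hyB y)).2].
Qed.

Lemma exists_chart : (0 < n)%N -> exists q B, isometric_chart (hyperplane p w) q B.
Proof.
move=> n0.
pose u : 'rV[R]_(1 + n) := (Num.sqrt d)^-1 *: w.
have uu : dotrv u u = 1.
  rewrite dotrvZl dotrvC dotrvZl dotrv_normal mulrA -invfM sqrtd_sqr mulVf//.
  by rewrite gt_eqF// d_gt0.
have u0 : u 0 0 != 1.
  apply/eqP => h.
  have : `|u 0 0| = (Num.sqrt d)^-1.
    rewrite mxE normrM ger0_norm ?invr_ge0 ?sqrtr_ge0//.
    by case: (normal_entry 0) => ->; rewrite ?normrN normr1 mulr1.
  rewrite h normr1 => /(congr1 (fun x => x^-1 ^+ 2)); rewrite invrK sqr_sqrtr ?(ltW d_gt0)// invr1 expr1n /d.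
  by move=> /eqP; rewrite eq_sym pnatr_eq1 => /eqP[] n1; rewrite n1 in n0.
have [B [uB BB uuBB]] := exists_orthonormal_rows uu u0.
exists p, (B : 'M[R]_(n.+1.-1, n.+1)); split; first exact: BB.
have wu : w = Num.sqrt d *: u by rewrite scalerA divff ?scale1r// gt_eqF// sqrtd_gt0.
apply/seteqP; split => [_ [y _ <-]|x hx].
  rewrite /hyperplane /= [p + _]addrC addrK.
  have : (y : 'rV_n) *m B *m u^T = 0.
    by rewrite -mulmxA; apply: trmx_inj; rewrite trmx_mul trmx_mul trmxK uB mul0mx trmx0.
  by rewrite dotrvC wu dotrvZl dotrvC {1}/dotrv => ->; rewrite mxE mulr0.
exists ((x - p : 'rV_(1 + n)) *m B^T) => //.
have xu : (x - p : 'rV_(1 + n)) *m u^T = 0.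
  by rewrite mulmx_trE dotrvC dotrvZl dotrvC hx mulr0 raddf0.
have -> : (x - p : 'rV_(1 + n)) *m B^T *m B = x - p.
  rewrite -mulmxA -[RHS]mulmx1 -uuBB mulmxDr [X in _ = X + _]mulmxA xu mul0mx add0r.
  by [].
by rewrite addrC subrK.
Qed.

Variable V : R -> R.
Hypothesis HV : forall (e : 'I_n -> R) c, (forall i, e i = 1 \/ e i = -1) ->
  lebesgue_rv (slab e c) = (V c)%:E.

Lemma hyperplane_volumeE : (0 < n)%N ->
  hyperplane_volume (hyperplane p w) (hyperplane p w `&` @hypercube R n.+1) =
  Num.sqrt d * V (dotrv (p - o) w).
Proof.
move=> n0; rewrite /hyperplane_volume; apply: xget_unique.
  have [q [B hB]] := exists_chart n0; exists q, B; split=> //.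
  rewrite chart_volume// HV//.
  by move=> i; exact: normal_entry.
move=> v [q [B [hB ->]]]; rewrite chart_volume// HV//.
by move=> i; exact: normal_entry.
Qed.

End chart.

(** All the admissible hyperplanes give this same value, which the choice in
[section_volume] must therefore return.  The slabs only enter through their
volume [V], whose parity absorbs the side of the center on which the hyperplane
lies. *)
Lemma section_volumeE n (V : R -> R) (t : R) : (0 < n)%N -> 0 <= t ->
  (forall c, V (- c) = V c) ->
  (forall (e : 'I_n -> R) c, (forall i, e i = 1 \/ e i = -1) ->
     lebesgue_rv (slab e c) = (V c)%:E) ->
  section_volume n.+1 t = Num.sqrt n.+1%:R * V (t * Num.sqrt n.+1%:R).
Proof.
move=> n0 t0 Vn HV.
have VE c : `|c| = t * Num.sqrt n.+1%:R -> V c = V (t * Num.sqrt n.+1%:R).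
  by move=> <-; case: (ger0P c) => // _; rewrite Vn.
(* the volume does not depend on the diagonal nor on the hyperplane *)
have key a p : is_vertex a ->
   eucl_dist (@hypercube_center R n.+1) (hyperplane p (opposite_vertex a - a)) = t ->
   hyperplane_volume (hyperplane p (opposite_vertex a - a))
     (hyperplane p (opposite_vertex a - a) `&` @hypercube R n.+1) =
   Num.sqrt n.+1%:R * V (t * Num.sqrt n.+1%:R).
  move=> va; rewrite eucl_dist_hyperplane ?dotrv_normal ?d_gt0// => ht.
  rewrite (hyperplane_volumeE p va HV n0) (VE (dotrv _ _))// -ht.
  by rewrite /eucl_norm dotrv_normal// divfK// gt_eqF// sqrtd_gt0.
(* a hyperplane orthogonal to the main diagonal, at distance [t] *)
have [p hp] : exists p : 'rV[R]_n.+1, eucl_dist (@hypercube_center R n.+1)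
    (hyperplane p (opposite_vertex 0 - 0)) = t.
  have v0 : is_vertex (0 : 'rV[R]_n.+1) by move=> i; left; rewrite mxE.
  set w := opposite_vertex 0 - 0.
  have ww : dotrv w w = n.+1%:R by exact: dotrv_normal.
  exists (hypercube_center n.+1 + (t / Num.sqrt n.+1%:R) *: w).
  rewrite eucl_dist_hyperplane ?ww ?d_gt0// [_ + (_ *: w)]addrC addrK dotrvZl.
  have := sqrtd_sqr n; have := sqrtd_gt0 n; rewrite /eucl_norm ww.
  set r := Num.sqrt _ => r0 rr; rewrite -rr mulrA divfK ?gt_eqF//.
  by rewrite ger0_norm ?mulfK ?gt_eqF// mulr_ge0// ltW.
have v0 : is_vertex (0 : 'rV[R]_n.+1) by move=> i; left; rewrite mxE.
rewrite /section_volume; apply: xget_unique.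
  exists (hyperplane p (opposite_vertex 0 - 0)); last by rewrite key.
  by exists 0, p; split.
by move=> v [H [a [q [va -> hq]]] ->]; exact: key.
Qed.

End sections_of_the_cube.

(** * Alternating Taylor bounds *)

Section taylor.
Context {R : realType}.

(** The form of the mean value theorem that raises by one the order of a Taylor
bound. *)
Lemma ge0_of_derive (f g : R -> R) : (forall x : R, is_derive x 1 f (g x)) ->
  0 <= f 0 -> (forall x, 0 <= x -> 0 <= g x) -> forall x, 0 <= x -> 0 <= f x.
Proof.
move=> df f0 g0 x; rewrite le_eqVlt => /predU1P[<-//|x0].
have cf : {within `[0, x], continuous f}.
  apply: continuous_subspaceT => y.
  by apply/differentiable_continuous/derivable1_diffP; case: (df y).
have [c /[!in_itv]/=/andP[c0 _]] := MVT x0 (fun y _ => df y) cf.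
rewrite subr0 => h; rewrite -(subrK (f 0) (f x)) h addr_ge0// mulr_ge0 ?g0//; exact: ltW.
Qed.

Definition dpow n (x : R) : R := x ^+ n / n`!%:R.

Lemma dpow0 n : dpow n.+1 0 = 0.
Proof. by rewrite /dpow expr0n mul0r. Qed.

Lemma is_derive_dpow n (x : R) : is_derive x 1 (dpow n.+1) (dpow n x).
Proof.
have -> : dpow n.+1 = (n.+1`!%:R)^-1 \*: ((@idfun R) ^+ n.+1).
  by apply/funext => y; rewrite /dpow mulrC fctE /=.
apply: is_derive_eq.
rewrite /dpow factS natrM /= -[_ *: _]/(_ * _) -[_ *: _]/(_ * _) mulr1.
have h : n.+1%:R != 0 :> R by rewrite pnatr_eq0.
have h' : n`!%:R != 0 :> R by rewrite pnatr_eq0 -lt0n fact_gt0.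
by rewrite invfM mulrACA mulVf// mul1r mulrC.
Qed.

Definition taylor_sin n (x : R) := \sum_(k < n) (-1) ^+ k * dpow k.*2.+1 x.
Definition taylor_cos n (x : R) := \sum_(k < n) (-1) ^+ k * dpow k.*2 x.
Definition taylor_expN n (x : R) := \sum_(k < n) (-1) ^+ k * dpow k x.

Lemma is_derive_lincomb (c : nat -> R) (f g : nat -> R -> R) n (x : R) :
  (forall k, is_derive x 1 (f k) (g k x)) ->
  is_derive x 1 (fun y => \sum_(k < n) c k * f k y) (\sum_(k < n) c k * g k x).
Proof.
move=> h.
have -> : (fun y => \sum_(k < n) c k * f k y) = \sum_(k < n) (c k \*: f k).
  by apply/funext => y; rewrite fct_sumE.
by apply: is_derive_sum => k; apply: is_deriveZ.
Qed.

Lemma is_derive_taylor_sin n (x : R) : is_derive x 1 (taylor_sin n) (taylor_cos n x).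
Proof.
apply: (@is_derive_lincomb (fun k => (-1) ^+ k) (fun k => dpow k.*2.+1) (fun k => dpow k.*2)) => k.
exact: is_derive_dpow.
Qed.

Lemma is_derive_taylor_cos n (x : R) : is_derive x 1 (taylor_cos n.+1) (- taylor_sin n x).
Proof.
have -> : taylor_cos n.+1 = cst 1 + (fun y => \sum_(k < n) (-1) ^+ k.+1 * dpow k.*2.+2 y).
  apply/funext => y; rewrite /taylor_cos big_ord_recl /= expr0 mul1r {1}/dpow expr0 fact0 divr1.
  by congr (_ + _); apply: eq_bigr => i _; rewrite lift0 doubleS.
have h : is_derive x 1 (fun y => \sum_(k < n) (-1) ^+ k.+1 * dpow k.*2.+2 y)
    (\sum_(k < n) (-1) ^+ k.+1 * dpow k.*2.+1 x).
  apply: (@is_derive_lincomb (fun k => (-1) ^+ k.+1) (fun k => dpow k.*2.+2) (fun k => dpow k.*2.+1)) => k.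
  exact: is_derive_dpow.
apply: (is_derive_eq (is_deriveD (is_derive_cst _ _ _) h)).
by rewrite add0r /taylor_sin -sumrN; apply: eq_bigr => k _; rewrite exprS mulN1r mulNr.
Qed.

Lemma is_derive_taylor_expN n (x : R) : is_derive x 1 (taylor_expN n.+1) (- taylor_expN n x).
Proof.
have -> : taylor_expN n.+1 = cst 1 + (fun y => \sum_(k < n) (-1) ^+ k.+1 * dpow k.+1 y).
  apply/funext => y; rewrite /taylor_expN big_ord_recl /= expr0 mul1r {1}/dpow expr0 fact0 divr1.
  by congr (_ + _); apply: eq_bigr => i _; rewrite lift0.
have h : is_derive x 1 (fun y => \sum_(k < n) (-1) ^+ k.+1 * dpow k.+1 y)
    (\sum_(k < n) (-1) ^+ k.+1 * dpow k x).
  apply: (@is_derive_lincomb (fun k => (-1) ^+ k.+1) (fun k => dpow k.+1) (fun k => dpow k)) => k.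
  exact: is_derive_dpow.
apply: (is_derive_eq (is_deriveD (is_derive_cst _ _ _) h)).
by rewrite add0r /taylor_expN -sumrN; apply: eq_bigr => k _; rewrite exprS mulN1r mulNr.
Qed.

Lemma taylor_sin0 n : taylor_sin n 0 = 0.
Proof. by rewrite /taylor_sin big1// => k _; rewrite dpow0 mulr0. Qed.

Lemma taylor_cos0 n : taylor_cos n.+1 0 = 1.
Proof.
rewrite /taylor_cos big_ord_recl big1 => [|k _]; last by rewrite lift0 doubleS dpow0 mulr0.
by rewrite expr0 mul1r addr0 /dpow fact0 divr1.
Qed.

Lemma taylor_expN0 n : taylor_expN n.+1 0 = 1.
Proof.
rewrite /taylor_expN big_ord_recl big1 => [|k _]; last by rewrite lift0 dpow0 mulr0.
by rewrite expr0 mul1r addr0 /dpow fact0 divr1.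
Qed.

(** Integrate [cos x <= 1] repeatedly between [0] and [x]. *)
Lemma sin_cos_taylor n (x : R) : 0 <= x ->
  0 <= (-1) ^+ n.+1 * (cos x - taylor_cos n.+1 x) /\ 0 <= (-1) ^+ n.+1 * (sin x - taylor_sin n.+1 x).
Proof.
pose A n := forall x : R, 0 <= x -> 0 <= (-1) ^+ n.+1 * (cos x - taylor_cos n.+1 x).
pose B n := forall x : R, 0 <= x -> 0 <= (-1) ^+ n.+1 * (sin x - taylor_sin n.+1 x).
have AB k : A k -> B k.
  move=> Ak; apply: (@ge0_of_derive _ (fun x => (-1) ^+ k.+1 * (cos x - taylor_cos k.+1 x))); last exact: Ak.
    move=> y; have := is_derive_taylor_sin k.+1 y => h.
    have -> : (fun x => (-1) ^+ k.+1 * (sin x - taylor_sin k.+1 x)) = (-1) ^+ k.+1 \*: (sin - taylor_sin k.+1).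
      by apply/funext.
    exact: is_deriveZ.
  by rewrite sin0 taylor_sin0 subr0 mulr0.
have BA k : B k -> A k.+1.
  move=> Bk; apply: (@ge0_of_derive _ (fun x => (-1) ^+ k.+1 * (sin x - taylor_sin k.+1 x))); last exact: Bk.
    move=> y; have := is_derive_taylor_cos k.+1 y => h.
    have -> : (fun x => (-1) ^+ k.+2 * (cos x - taylor_cos k.+2 x)) = (-1) ^+ k.+2 \*: (cos - taylor_cos k.+2).
      by apply/funext.
    apply: is_derive_eq.
    by rewrite /= -[_ *: _]/(_ * _) [_ ^+ k.+2]exprS; ring.
  by rewrite cos0 taylor_cos0 subrr mulr0.
have : A n /\ B n.
  elim: n => [|n [_ IH]]; last by split; [exact: BA|exact/AB/BA].
  suff A0 : A 0%N by split; [exact: A0|exact: AB].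
  move=> y _; rewrite /taylor_cos big_ord1 /dpow /= expr0 fact0 divr1 mul1r expr1.
  by have := cos_le1 y; lra.
by move=> [h1 h2] x0; split; [exact: h1|exact: h2].
Qed.

(** Integrate [0 <= expR (- x)] repeatedly between [0] and [x]. *)
Lemma expRN_taylor n (x : R) : 0 <= x -> 0 <= (-1) ^+ n * (expR (- x) - taylor_expN n x).
Proof.
move: x; elim: n => [|n IH] x x0.
  by rewrite /taylor_expN big_ord0 subr0 expr0 mul1r expR_ge0.
move: x x0; apply: (@ge0_of_derive _ (fun x => (-1) ^+ n * (expR (- x) - taylor_expN n x))); last exact: IH.
  move=> y; have := is_derive_taylor_expN n y => h.
  have -> : (fun x => (-1) ^+ n.+1 * (expR (- x) - taylor_expN n.+1 x)) =
     (-1) ^+ n.+1 \*: ((expR \o -%R) - taylor_expN n.+1) by apply/funext.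
  apply: is_derive_eq.
  rewrite /= -![_ *: _]/(_ * _) [_ ^+ n.+1]exprS; ring.
by rewrite oppr0 expR0 taylor_expN0 subrr mulr0.
Qed.

End taylor.

(** * The cardinal sine *)

Section sinc.
Context {R : realType}.

Definition sinc (x : R) : R := if x == 0 then 1 else sin x / x.

Lemma sinc0 : sinc 0 = 1. Proof. by rewrite /sinc eqxx. Qed.

Lemma mulr_sinc x : x * sinc x = sin x.
Proof.
rewrite /sinc; case: eqVneq => [->|x0]; first by rewrite mul0r sin0.
by rewrite mulrC divfK.
Qed.

Lemma sincN x : sinc (- x) = sinc x.
Proof. by rewrite /sinc oppr_eq0 sinN invrN mulrNN. Qed.

Lemma sinc_norm x : sinc `|x| = sinc x.
Proof. by case: (ger0P x) => // _; rewrite sincN. Qed.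

Lemma sinc_taylor (x : R) : let q := x ^+ 2 in
  [/\ 1 - q / 6 <= sinc x,
      sinc x <= 1 - q / 6 + q ^+ 2 / 120,
      1 - q / 6 + q ^+ 2 / 120 - q ^+ 3 / (120 * 42) <= sinc x &
      sinc x <= 1 - q / 6 + q ^+ 2 / 120 - q ^+ 3 / (120 * 42) + q ^+ 4 / (120 * 42 * 72)].
Proof.
rewrite /= -sinc_norm -(real_normK (num_real x)).
have [->|x0] := eqVneq `|x| 0; first by rewrite sinc0 !expr0n /=; split; lra.
have {x0} : 0 < `|x| by rewrite lt_neqAle eq_sym x0 normr_ge0.
move: `|x| => {}x x0.
have := (sin_cos_taylor 1 (ltW x0)).2; have := (sin_cos_taylor 2 (ltW x0)).2.
have := (sin_cos_taylor 3 (ltW x0)).2; have := (sin_cos_taylor 4 (ltW x0)).2.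
rewrite /taylor_sin !big_ord_recr !big_ord0 /dpow /= -mulr_sinc.
rewrite -[4.*2.+1]/9%N -[3.*2.+1]/7%N -[2.*2.+1]/5%N -[1.*2.+1]/3%N -[0.*2.+1]/1%N.
have f k : k.+1`!%:R = k.+1%:R * k`!%:R :> R by rewrite factS natrM.
have f1 : 1`!%:R = 1 :> R by [].
have f3 : 3`!%:R = 6 :> R by rewrite !f f1; ring.
have f5 : 5`!%:R = 120 :> R by rewrite !(f 4, f 3)%N f3; ring.
have f7 : 7`!%:R = 120 * 42 :> R by rewrite (f 6)%N (f 5)%N f5; ring.
have f9 : 9`!%:R = 120 * 42 * 72 :> R by rewrite (f 8)%N (f 7)%N f7; ring.
rewrite f9 f7 f5 f3 f1.
set y := sinc x => h1 h2 h3 h4.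
split; rewrite -(ler_pM2l x0).
- suff : x * (1 - x ^+ 2 / 6) = x - x ^+ 3 / 6 by move=> ->; clear - h4; lra.
  by field.
- suff : x * (1 - x ^+ 2 / 6 + (x ^+ 2) ^+ 2 / 120) = x - x ^+ 3 / 6 + x ^+ 5 / 120 by move=> ->; clear - h3; lra.
  by field.
- suff : x * (1 - x ^+ 2 / 6 + (x ^+ 2) ^+ 2 / 120 - (x ^+ 2) ^+ 3 / (120 * 42)) =
    x - x ^+ 3 / 6 + x ^+ 5 / 120 - x ^+ 7 / (120 * 42) by move=> ->; clear - h2; lra.
  by field.
- suff : x * (1 - x ^+ 2 / 6 + (x ^+ 2) ^+ 2 / 120 - (x ^+ 2) ^+ 3 / (120 * 42) + (x ^+ 2) ^+ 4 / (120 * 42 * 72)) =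
    x - x ^+ 3 / 6 + x ^+ 5 / 120 - x ^+ 7 / (120 * 42) + x ^+ 9 / (120 * 42 * 72) by move=> ->; clear - h1; lra.
  by field.
Qed.

Lemma norm_mulr_sinc_le1 x : `|x| * `|sinc x| <= 1.
Proof. by rewrite -normrM mulr_sinc sin_max. Qed.

Lemma norm_sinc_le1 x : `|sinc x| <= 1.
Proof.
have [x1|x1] := leP 1 `|x|.
  by have := norm_mulr_sinc_le1 x; have := normr_ge0 (sinc x); nra.
have [h1 h2 _ _] := sinc_taylor x; rewrite -(real_normK (num_real x)) in h1 h2.
have : `|x| ^+ 2 <= 1 by rewrite expr_le1// ltW.
move: (`|x| ^+ 2) (sqr_ge0 `|x|) h1 h2 => q q0 h1 h2 q1.
have : q ^+ 2 <= q by rewrite expr2 ler_piMl.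
by rewrite ler_norml => q2; apply/andP; split; lra.
Qed.

(** Any constant smaller than 1 would make the powers of [sinc] decay
geometrically away from the origin; this one is compared with [expR (- 3 / 20)]
in [sinc_pow_far]. *)
Lemma norm_sinc_far x : 1 <= `|x| -> `|sinc x| <= 17 / 20.
Proof.
move=> x1; have [x2|x2] := leP 2 `|x|.
  have : `|x| * `|sinc x| <= 1 := norm_mulr_sinc_le1 x.
  have := normr_ge0 (sinc x); nra.
have [h1 h2 _ _] := sinc_taylor x; rewrite -(real_normK (num_real x)) in h1 h2.
have : 1 <= `|x| ^+ 2 <= 4 by apply/andP; split; nra.
move: (`|x| ^+ 2) h1 h2 => q h1 h2 /andP[q1 q4].
(* the chord of the parabola between [q = 1] and [q = 4] *)
have : q ^+ 2 <= 5 * q - 4 by rewrite expr2; nra.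
by rewrite ler_norml => q2; apply/andP; split; lra.
Qed.

Lemma sinc_exp_le x : `|x| <= 1 -> 0 <= sinc x <= expR (- (x ^+ 2 / 6)).
Proof.
move=> x1; have [h1 h2 _ _] := sinc_taylor x.
have : 0 <= x ^+ 2 <= 1 by rewrite sqr_ge0 -(real_normK (num_real x)) expr_le1.
move: (x ^+ 2) (sinc x) h1 h2 => q y h1 h2 /andP[q0 q1].
have q60 : 0 <= q / 6 by lra.
have := expRN_taylor 4 q60; rewrite /taylor_expN !big_ord_recr big_ord0 /dpow /=.
have -> : 3`!%:R = 6 :> R by congr (_%:R).
have -> : 2`!%:R = 2 :> R by congr (_%:R).
have -> : 1`!%:R = 1 :> R by [].
have q2 : 0 <= q ^+ 2 by rewrite sqr_ge0.
have q3 : q ^+ 3 <= q ^+ 2 by rewrite exprS; nra.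
move=> h; apply/andP; split; lra.
Qed.

(** The exponent is the Taylor polynomial of [ln (sinc x)] of degree 6, and
[q ^+ 4] has the order of the first term left out. *)
Lemma sinc_exp_approx x : `|x| <= 1 -> let q := x ^+ 2 in
  `|sinc x - expR (- (q / 6 + q ^+ 2 / 180 + q ^+ 3 / (45 * 63)))| <= q ^+ 4.
Proof.
move=> x1 /=; have [_ _ h1 h2] := sinc_taylor x.
have : 0 <= x ^+ 2 <= 1 by rewrite sqr_ge0 -(real_normK (num_real x)) expr_le1.
move: (x ^+ 2) (sinc x) h1 h2 => q y h1 h2 /andP[q0 q1].
have q_ge0 k : 0 <= q ^+ k by rewrite exprn_ge0.
set z := q / 6 + _ + _.
have z0 : 0 <= z.
  by have := q_ge0 2; have := q_ge0 3; rewrite /z; clear -q0; lra.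
have := expRN_taylor 4 z0; have := expRN_taylor 5 z0.
rewrite /taylor_expN !big_ord_recr big_ord0 /dpow /=.
have -> : 4`!%:R = 24 :> R by congr (_%:R).
have -> : 3`!%:R = 6 :> R by congr (_%:R).
have -> : 2`!%:R = 2 :> R by congr (_%:R).
have -> : 1`!%:R = 1 :> R by [].
have qd k : (4 <= k)%N -> q ^+ k <= q ^+ 4 by move=> k4; rewrite ler_wiXn2l.
have z4 : z ^+ 4 <= q ^+ 4.
  rewrite ler_pXn2r ?nnegrE//.
  have := q_ge0 2; have : q ^+ 2 <= q by rewrite expr2; nra.
  have : q ^+ 3 <= q ^+ 2 by rewrite exprS; have := q_ge0 2; nra.
  rewrite /z; lra.
move=> g1 g2.
rewrite ler_norml.
have q5 := qd 5 isT; have q6 := qd 6 isT; have q7 := qd 7 isT; have q8 := qd 8 isT.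
have q9 := qd 9 isT; have p4 := q_ge0 4; have p5 := q_ge0 5; have p6 := q_ge0 6.
have p7 := q_ge0 7; have p8 := q_ge0 8; have p9 := q_ge0 9.
have E : - q ^+ 4 / 2 <= 1 - z + z ^+ 2 / 2 - z ^+ 3 / 6 -
    (1 - q / 6 + q ^+ 2 / 120 - q ^+ 3 / (120 * 42)) <= 0.
  by rewrite /z; apply/andP; split; lra.
move: E => /andP[E1 E2].
by apply/andP; split; lra.
Qed.

Lemma continuous_sinc : continuous sinc.
Proof.
move=> x; have [->|x0] := eqVneq x 0.
  apply/cvgrPdist_le => e e0; near=> y.
  have [h1 _ _ _] := sinc_taylor y; have := norm_sinc_le1 y.
  rewrite sinc0 ler_norml => /andP[_ h2]; rewrite ger0_norm ?subr_ge0//.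
  have y1 : `|y| <= 1 by near: y; exists 1 => //= z; rewrite /ball_ /= sub0r normrN => /ltW.
  have ye : `|y| <= e by near: y; exists e => //= z; rewrite /ball_ /= sub0r normrN => /ltW.
  have : y ^+ 2 <= `|y|.
    by rewrite -(real_normK (num_real y)) expr2 ler_piMl.
  lra.
have : (fun y => sin y / y) @ x --> sinc x.
  rewrite /sinc (negbTE x0); apply: cvgM; first exact: continuous_sin.
  exact: cvgV.
apply: cvg_trans; apply: near_eq_cvg; near=> y.
rewrite /sinc (_ : (y == 0) = false)//; apply/negbTE.
by near: y; apply: (cvgr_neq0 x).
Unshelve. all: by end_near. Qed.

Lemma measurable_sinc : measurable_fun setT sinc.
Proof. by apply: continuous_measurable_fun; exact: continuous_sinc. Qed.

End sinc.

(** * Functions dominated by the Cauchy density *)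

Section integrability.
Context {R : realType}.
Local Notation mu := (@lebesgue_measure R).

Lemma integrable_invD1sqr : mu.-integrable setT (fun u : R => ((1 + u ^+ 2)^-1)%:E).
Proof.
have m : measurable_fun [set: R] (fun u : R => (1 + u ^+ 2)^-1).
  by apply: continuous_measurable_fun; exact: continuous_oneDsqrV.
apply/integrableP; split; first exact/measurable_EFinP.
under eq_integral.
  move=> x _; rewrite (_ : `| _ |%E = (((1 + x ^+ 2)^-1)%:E)); last first.
    by rewrite abse_EFin ger0_norm// invr_ge0 addr_ge0// sqr_ge0.
  over.
rewrite (@ge0_symfun_integralT R (fun x => (1 + x ^+ 2)^-1))//=.
- rewrite (_ : [set x | _] = `[0, +oo[%classic); last first.
    by apply/seteqP; split => x/=; rewrite in_itv/= andbT.
  by have := @integral0y_oneDsqr R; rewrite /oneDsqr => ->; rewrite -EFinM ltry.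
- by move=> x; rewrite invr_ge0 addr_ge0// sqr_ge0.
- exact: continuous_oneDsqrV.
- by move=> x /=; rewrite sqrrN.
Qed.

Lemma integrable_EFinZ (k : R) (f : R -> R) : mu.-integrable setT (EFin \o f) ->
  mu.-integrable setT (fun x => (k * f x)%:E).
Proof. by move=> h; exact: (integrableZl measurableT k h). Qed.

Lemma integrable_EFinD (f g : R -> R) : mu.-integrable setT (EFin \o f) ->
  mu.-integrable setT (EFin \o g) -> mu.-integrable setT (fun x => (f x + g x)%:E).
Proof. by move=> hf hg; exact: (integrableD measurableT hf hg). Qed.

Lemma integrable_le_invD1sqr (f : R -> R) (C : R) : measurable_fun setT f ->
  (forall u, `|f u| <= C / (1 + u ^+ 2)) -> mu.-integrable setT (EFin \o f).
Proof.
move=> mf fC.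
have h := integrableZl measurableT C integrable_invD1sqr.
apply: (le_integrable measurableT _ _ h); first exact/measurable_EFinP.
by move=> u _; rewrite -EFinM !abse_EFin lee_fin (le_trans (fC u))// ler_norm.
Qed.

Lemma le_Rintegral_invD1sqr (f : R -> R) (C : R) : measurable_fun setT f ->
  (forall u, `|f u| <= C / (1 + u ^+ 2)) ->
  `|\int[mu]_u f u| <= C * \int[mu]_u (1 + u ^+ 2)^-1.
Proof.
move=> mf fC; have If := integrable_le_invD1sqr mf fC.
apply: (le_trans (le_normr_Rintegral measurableT If)).
rewrite -RintegralZl//; last exact: integrable_invD1sqr.
apply: le_Rintegral => //; first exact: integrable_norm.
exact: (integrableZl measurableT C integrable_invD1sqr).
Qed.

Lemma Rintegral_gt0 (f : R -> R) : mu.-integrable setT (EFin \o f) ->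
  (forall u, 0 <= f u) -> (forall u, 0 <= u <= 1 -> 2^-1 <= f u) -> 0 < \int[mu]_u f u.
Proof.
move=> If f0 f1.
have : \int[mu]_u (2^-1 * \1_(`[0, 1]%classic : set R) u) <= \int[mu]_u f u.
  apply: le_Rintegral => //.
    by apply: integrable_EFinZ; exact: integrable_indic_itv.
  move=> u _ /=; rewrite indicE; case: (boolP (u \in _)) => [|_]; last by rewrite mulr0.
  by rewrite inE/= in_itv/= => /f1; rewrite mulr1.
apply: lt_le_trans.
rewrite RintegralZl//; last exact: integrable_indic_itv.
rewrite mulr_gt0// /Rintegral integral_indic//= setIT lebesgue_measure_itv/= lte01.
by rewrite oppr0 adde0.
Qed.

End integrability.

(** * Volumes of slabs as Fourier integrals *)

Section fourier.
Context {R : realType}.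
Local Notation mu := (@lebesgue_measure R).

Lemma sinc_pow_le d (u : R) : (1 < d)%N -> `|sinc u ^+ d| <= 2 / (1 + u ^+ 2).
Proof.
move=> d1; have u1 : 0 < 1 + u ^+ 2 by rewrite ltr_pwDl ?sqr_ge0.
rewrite ler_pdivlMr// normrX.
apply: (@le_trans _ _ (`|sinc u| ^+ 2 * (1 + u ^+ 2))).
  by rewrite ler_wpM2r ?(ltW u1)// ler_wiXn2l// norm_sinc_le1.
have h1 : `|sinc u| ^+ 2 <= 1 by rewrite expr_le1 ?norm_sinc_le1.
have h2 : `|sinc u| ^+ 2 * u ^+ 2 <= 1.
  rewrite -[u ^+ 2](real_normK (num_real u)) -exprMn expr_le1 ?mulr_ge0// mulrC.
  exact: norm_mulr_sinc_le1.
lra.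
Qed.

Lemma measurable_sinc_cos d (x : R) : measurable_fun setT (fun u : R => sinc u ^+ d * cos (2 * x * u)).
Proof.
apply: measurable_funM; first by apply: measurable_funX; exact: measurable_sinc.
apply: (measurableT_comp (f := cos)).
  by apply: continuous_measurable_fun; exact: continuous_cos.
exact: measurable_funM.
Qed.

Lemma sinc_cos_le d (x u : R) : (1 < d)%N ->
  `|sinc u ^+ d * cos (2 * x * u)| <= 2 / (1 + u ^+ 2).
Proof.
move=> d1; rewrite normrM; apply: le_trans (sinc_pow_le u d1).
by rewrite ler_piMr// cos_max.
Qed.

Lemma integrable_sinc_cos d (x : R) : (1 < d)%N ->
  mu.-integrable setT (fun u : R => (sinc u ^+ d * cos (2 * x * u))%:E).
Proof.
move=> d1; apply: (@integrable_le_invD1sqr _ _ 2); first exact: measurable_sinc_cos.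
by move=> u; exact: sinc_cos_le.
Qed.

Definition sinc_fourier d (x : R) : R := \int[mu]_u (sinc u ^+ d * cos (2 * x * u)).

Lemma sinc_fourierN d x : sinc_fourier d (- x) = sinc_fourier d x.
Proof. by apply: eq_Rintegral => u _; rewrite mulrN mulNr cosN. Qed.

(** The normalising constant of the Fourier transform, equal to pi. *)
Definition sinc_sqr_integral : R := \int[mu]_u (sinc u ^+ 2).
Local Notation W := sinc_sqr_integral.

Lemma integrable_sinc_sqr : mu.-integrable setT (fun u : R => (sinc u ^+ 2)%:E).
Proof.
apply: (@integrable_le_invD1sqr _ _ 2); first by apply: measurable_funX; exact: measurable_sinc.
by move=> u; exact: sinc_pow_le.
Qed.

Lemma integral_sinc_sqr_scale (a : R) :
  mu.-integrable setT (fun u : R => (a ^+ 2 * sinc (a * u) ^+ 2)%:E) /\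
  \int[mu]_u (a ^+ 2 * sinc (a * u) ^+ 2) = `|a| * W.
Proof.
have [->|a0] := eqVneq a 0.
  split; first by under eq_fun do rewrite expr0n mul0r; exact: integrable0.
  rewrite normr0 mul0r (@eq_Rintegral _ _ _ _ _ (cst 0)) ?Rintegral_cst//.
    by rewrite mul0r.
  by move=> u _; rewrite expr0n mul0r.
have [h1 h2] := @Rintegral_affine R a 0 _ a0 integrable_sinc_sqr.
have e : (fun x : R => (sinc (a * x + 0) ^+ 2)%:E) = (fun x : R => (sinc (a * x) ^+ 2)%:E).
  by apply/funext => x; rewrite addr0.
rewrite e in h1; split; first exact: (integrable_EFinZ _ h1).
rewrite RintegralZl// /W h2 mulrA -expr2 real_normK ?num_real//.
by congr (_ * _); apply: eq_Rintegral => x _; rewrite addr0.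
Qed.

(** After multiplication by [u ^+ 2] this is the linearisation of
[sin u ^+ 2 * cos (2 * x * u)].  Each term on the right has an integral that is
a multiple of [W], by a change of scale. *)
Lemma sinc_sqr_cos (x u : R) : sinc u ^+ 2 * cos (2 * x * u) =
  2^-1 * ((x + 1) ^+ 2 * sinc ((x + 1) * u) ^+ 2 + (x - 1) ^+ 2 * sinc ((x - 1) * u) ^+ 2)
  - x ^+ 2 * sinc (x * u) ^+ 2.
Proof.
have [->|u0] := eqVneq u 0.
  by rewrite !mulr0 sinc0 cos0; field.
apply: (mulfI (expf_neq0 2 u0)).
have E a : u ^+ 2 * (a ^+ 2 * sinc (a * u) ^+ 2) = sin (a * u) ^+ 2.
  by rewrite -(mulr_sinc (a * u)); ring.
rewrite mulrBr [X in _ = X - _]mulrCA [X in _ = _ * X - _]mulrDr !E.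
have -> : 2 * x * u = (x * u) *+ 2 by ring.
rewrite mulrA -exprMn mulr_sinc mulrDl mul1r mulrBl mul1r cos_mulr2n sinD sinB.
have := cos2Dsin2 u; have := cos2Dsin2 (x * u).
move: (sin u) (cos u) (sin (x * u)) (cos (x * u)) => s c S C h1 h2.
have -> : C ^+ 2 = 1 - S ^+ 2 by rewrite -h1; ring.
have E1 : (S * c + C * s) ^+ 2 = S ^+ 2 * c ^+ 2 + C ^+ 2 * s ^+ 2 + 2 * (S * c * C * s) by ring.
have E2 : (S * c - C * s) ^+ 2 = S ^+ 2 * c ^+ 2 + C ^+ 2 * s ^+ 2 - 2 * (S * c * C * s) by ring.
rewrite E1 E2.
have -> : c ^+ 2 = 1 - s ^+ 2 by rewrite -h2; ring.
have -> : C ^+ 2 = 1 - S ^+ 2 by rewrite -h1; ring.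
by field.
Qed.

(** The triangular density of a sum of two uniform variables. *)
Lemma sinc_fourier2 (x : R) : sinc_fourier 2 x = W * Num.max 0 (1 - `|x|).
Proof.
have [i1 e1] := integral_sinc_sqr_scale (x + 1).
have [i2 e2] := integral_sinc_sqr_scale (x - 1).
have [i3 e3] := integral_sinc_sqr_scale x.
rewrite /sinc_fourier; under eq_Rintegral do rewrite sinc_sqr_cos.
rewrite RintegralB//; last first.
  by apply: integrable_EFinZ; exact: integrable_EFinD.
rewrite [X in X - _]RintegralZl//; last first.
  exact: (integrable_EFinD i1 i2).
rewrite RintegralD// e1 e2 e3.
have -> : 2^-1 * (`|x + 1| * W + `|x - 1| * W) - `|x| * W = W * (2^-1 * (`|x + 1| + `|x - 1|) - `|x|) by ring.
congr (_ * _).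
case: (ler0P x) => ?; case: (ler0P (x + 1)) => ?; case: (ler0P (x - 1)) => ?.
all: match goal with |- context [Num.max 0 (1 - ?a)] => case: (leP 0 (1 - a)) => ? end; lra.
Qed.

Lemma sinc_sqr_integral_gt0 : 0 < W.
Proof.
apply: Rintegral_gt0; [exact: integrable_sinc_sqr|by move=> u; exact: sqr_ge0|].
move=> u /andP[u0 u1]; have [h _ _ _] := sinc_taylor u.
have : u ^+ 2 <= 1 by rewrite expr_le1.
nra.
Qed.

(** The characteristic function of a uniform variable. *)
Lemma integral_cos_itv (c e u : R) : e = 1 \/ e = -1 ->
  (\int[mu]_(z in `[0%R, 1%R]) (cos (2 * (c - e * (z - 2^-1)) * u))%:E = (sinc u * cos (2 * c * u))%:E)%E.
Proof.
move=> e1.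
have [->|u0] := eqVneq u 0.
  under eq_integral do rewrite mulr0 cos0.
  rewrite integral_cst//= lebesgue_measure_itv/= lte01 oppr0 adde0 mule1.
  by rewrite sinc0 mulr0 cos0 mulr1.
have e0 : e != 0 by case: e1 => ->; rewrite ?oppr_eq0 oner_eq0.
pose b := 2 * c * u + e * u.
pose a := - (2 * e * u).
have a0 : a != 0 by rewrite oppr_eq0 !mulf_neq0.
(* the cosine has the primitive [F] since its argument is affine in [z] *)
pose lin (z : R) := a * z + b.
have linE z : 2 * (c - e * (z - 2^-1)) * u = lin z by rewrite /lin /a /b; field.
pose F (z : R) := a^-1 * sin (lin z).
have dlin (z : R) : is_derive z 1 lin a.
  have -> : lin = a \*: @idfun R + cst b by apply/funext.
  by apply: is_derive_eq; rewrite addr0 -[LHS]/(a * 1) mulr1.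
have dF (z : R) : is_derive z 1 F (cos (lin z)).
  have -> : F = a^-1 \*: (sin \o lin) by apply/funext.
  apply: is_derive_eq; rewrite -[LHS]/(a^-1 * (cos (lin z) * a)).
  by rewrite mulrC mulfK.
have cc : continuous (fun z => cos (lin z)).
  move=> z; apply: (@continuous_comp _ _ _ lin cos); last exact: continuous_cos.
  by apply/differentiable_continuous/derivable1_diffP; case: (dlin z).
under eq_integral do rewrite linE.
rewrite (@continuous_FTC2 _ (fun z => cos (lin z)) F)//.
- rewrite -EFinB /F /lin mulr0 add0r mulr1 -mulrBr.
  rewrite (_ : a + b = 2 * c * u - e * u); last by rewrite /a /b; ring.
  rewrite sinB /b sinD; congr EFin.
  rewrite /a /sinc (negbTE u0).
  by case: e1 => e1; rewrite e1 ?mul1r ?mulN1r ?sinN ?cosN; field.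
- exact: continuous_subspaceT.
- split.
  + by move=> x _; case: (dF x).
  + apply: cvg_at_right_filter; apply/differentiable_continuous/derivable1_diffP.
    by case: (dF 0).
  + apply: cvg_at_left_filter; apply/differentiable_continuous/derivable1_diffP.
    by case: (dF 1).
- by move=> x _; rewrite derive1E; case: (dF x).
Qed.

Lemma integral_indicr (D : set R) (h : R -> R) : measurable D ->
  (\int[mu]_(x in D) (h x)%:E = \int[mu]_x (\1_D x * h x)%:E)%E.
Proof.
move=> mD; rewrite integral_mkcond; apply: eq_integral => x _.
by rewrite patchE indicE; case: ifP => _; rewrite ?mul1r ?mul0r.
Qed.

Lemma EFin_Rintegral (h : R -> R) : mu.-integrable setT (EFin \o h) ->
  (\int[mu]_x (h x)%:E = (\int[mu]_x h x)%:E)%E.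
Proof. by move=> h1; rewrite /Rintegral fineK//; exact: integrable_fin_num. Qed.

(** Exchanging the integrals, the average of the cosine over [[0, 1]] supplies
the extra factor [sinc]. *)
Lemma sinc_fourier_rec d (c e : R) : (1 < d)%N -> e = 1 \/ e = -1 ->
  mu.-integrable `[0, 1] (fun z => (sinc_fourier d (c - e * (z - 2^-1)))%:E) /\
  (\int[mu]_(z in `[0%R, 1%R]) (sinc_fourier d (c - e * (z - 2^-1)))%:E = (sinc_fourier d.+1 c)%:E)%E.
Proof.
move=> d1 e1.
pose D : set R := `[0, 1]%classic.
have mD : measurable D by exact: measurable_itv.
have mI : measurable_fun setT (fun zu : measurableTypeR R * measurableTypeR R => \1_D zu.1 : R).
  by apply: (measurableT_comp (f := \1_D : R -> R)) => //; exact: measurable_indic.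
pose f (zu : measurableTypeR R * measurableTypeR R) : \bar R :=
  (\1_D zu.1 *
   (sinc zu.2 ^+ d * cos (2 * (c - e * (zu.1 - 2^-1)) * zu.2)))%:E.
(* [g] dominates [f] and is a product of integrable functions *)
pose g (zu : measurableTypeR R * measurableTypeR R) : \bar R :=
  (\1_D zu.1 * (2 / (1 + zu.2 ^+ 2)))%:E.
have mf : measurable_fun setT f.
  apply/measurable_EFinP; apply: measurable_funM => //.
  apply: measurable_funM.
    apply: measurable_funX; apply: (measurableT_comp (f := sinc)) => //; exact: measurable_sinc.
  apply: (measurableT_comp (f := cos)).
    by apply: continuous_measurable_fun; exact: continuous_cos.
  apply: measurable_funM => //; apply: measurable_funM => //.
  apply: measurable_funB => //; apply: measurable_funM => //.
  exact: measurable_funB.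
have mg : measurable_fun setT g.
  apply/measurable_EFinP; apply: measurable_funM => //.
  apply: measurable_funM => //.
  apply: (measurableT_comp (f := fun x : R => (1 + x ^+ 2)^-1)) => //.
  by apply: continuous_measurable_fun; exact: continuous_oneDsqrV.
have g0 x u : 0 <= \1_D x * (2 / (1 + u ^+ 2)) :> R.
  by rewrite mulr_ge0// ?indicE// divr_ge0// addr_ge0// sqr_ge0.
have Ig : (@lebesgue_measure R \x @lebesgue_measure R)%E.-integrable setT g.
  apply/integrable21ltyP => //.
  rewrite (_ : (\int[_]_y _)%E = (\int[mu]_u (2 * (1 + u ^+ 2)^-1)%:E)%E).
    by apply: integrable_lty => //; apply: integrable_EFinZ; exact: integrable_invD1sqr.
  apply: eq_integral => u _.
  under eq_integral do rewrite /g abse_EFin ger0_norm// EFinM.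
  transitivity (\int[mu]_x (\1_D x)%:E * (2 / (1 + u ^+ 2))%:E)%E.
    rewrite -ge0_integralZr//.
    - by apply/measurable_EFinP; exact: measurable_indic.
    - by rewrite lee_fin divr_ge0// addr_ge0// sqr_ge0.
  by rewrite integral_indic//= setIT lebesgue_measure_itv/= lte01 oppr0 adde0 mul1e.
have If : (@lebesgue_measure R \x @lebesgue_measure R)%E.-integrable setT f.
  apply: (le_integrable measurableT mf _ Ig) => -[x u] _.
  rewrite /f /g !abse_EFin lee_fin /= [leRHS]ger0_norm// normrM.
  rewrite ger0_norm ?indicE// ler_wpM2l//; exact: sinc_cos_le.
have FE x : (\int[mu]_y f (x, y) = (\1_D x * sinc_fourier d (c - e * (x - 2^-1)))%:E)%E.
  rewrite /f /= EFin_Rintegral; last by apply: integrable_EFinZ; exact: integrable_sinc_cos.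
  by rewrite RintegralZl//; exact: integrable_sinc_cos.
split.
  have := integrable_fubini_F If; rewrite /fubini_F => h.
  have h' : mu.-integrable setT (fun x => (\1_D x * sinc_fourier d (c - e * (x - 2^-1)))%:E).
    by apply: eq_integrable h => // x _; rewrite FE.
  have h2 : mu.-integrable D (fun x => (\1_D x * sinc_fourier d (c - e * (x - 2^-1)))%:E).
    by apply: integrableS h'.
  apply: eq_integrable h2 => // x xD.
  by rewrite indicE xD mul1r.
transitivity (\int[mu]_x \int[mu]_y f (x, y))%E.
  by rewrite -/D integral_indicr//; apply: eq_integral => x _; rewrite FE.
rewrite (Fubini If).
rewrite /sinc_fourier -EFin_Rintegral; last exact: (@integrable_sinc_cos d.+1 c (ltnW d1)).
apply: eq_integral => u _.
transitivity ((sinc u ^+ d)%:E * \int[mu]_(x in D) (cos (2 * (c - e * (x - 2^-1)) * u))%:E)%E.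
  rewrite integral_indicr// -integralZl//.
    by apply: eq_integral => x _; rewrite /f /= -EFinM; congr EFin; ring.
  apply: (le_integrable measurableT _ _ (@integrable_indic_itv R 0 1 true false)).
    apply/measurable_EFinP; apply: measurable_funM; first exact: measurable_indic.
    apply: (measurableT_comp (f := cos)).
      by apply: continuous_measurable_fun; exact: continuous_cos.
    apply: measurable_funM => //; apply: measurable_funM => //.
    apply: measurable_funB => //; apply: measurable_funM => //.
    exact: measurable_funB.
  move=> x _; rewrite !abse_EFin lee_fin normrM -[leRHS]mulr1 ler_wpM2l// cos_max//.
by rewrite integral_cos_itv// -EFinM mulrA -exprSr.
Qed.

Lemma slab_consv n (e : 'I_n.+1 -> R) c x (y : rvec R n) :
  slab e c (consv (x, y)) <-> (0 <= x <= 1) /\ slab (fun i => e (lift ord0 i)) (c - e ord0 * (x - 2^-1)) y.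
Proof.
have E : c - \sum_i e i * (consv (x, y) 0 i - 2^-1) =
   c - e ord0 * (x - 2^-1) - \sum_i e (lift ord0 i) * (y 0 i - 2^-1).
  rewrite big_ord_recl consv0 opprD addrA /=; congr (_ - _).
  by apply: eq_bigr => i _; rewrite consvS.
rewrite /slab /= E; split=> [[h1 h2]|[h1 [h2 h3]]].
  split; first by have := h1 ord0; rewrite consv0.
  by split => // i; have := h1 (lift ord0 i); rewrite consvS.
by split => // i; case: (unliftP ord0 i) => [j ->|->]; rewrite ?consvS ?consv0.
Qed.

(** The slab is the interval of length 1 starting at [e ord0 * c], cut by
[[0, 1]]. *)
Lemma vol_slab1 (e : 'I_1 -> R) c : (forall i, e i = 1 \/ e i = -1) ->
  lebesgue_rv (slab e c) = (Num.max 0 (1 - `|c|))%:E.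
Proof.
move=> he.
pose c' := e ord0 * c.
transitivity (mu `[Num.max 0 c', Num.min 1 (c' + 1)]%classic).
  rewrite -[RHS]mul1e -integral_cst//= [RHS]integral_mkcond.
  apply: eq_integral => x _; rewrite patchE indicE.
  have E : slab e c (consv (x, 0 : rvec R 0)) <->
      x \in (`[Num.max 0 c', Num.min 1 (c' + 1)]%classic : set R).
    apply: (iff_trans (slab_consv _ _ _ _)).
    rewrite inE /= in_itv/= ge_max le_min /slab /= big_ord0 subr0.
    have -> : (`|c - e ord0 * (x - 2^-1)| <= 2^-1) = (c' <= x <= c' + 1).
      rewrite ler_norml /c'; case: (he ord0) => ->; apply/andP/andP => -[]; split; lra.
    split=> [[/andP[-> ->] [_ /andP[-> ->]]//]|/andP[/andP[-> ->] /andP[-> ->]]].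
    by split => //; split => // -[].
  case: (boolP (x \in _)) => [/E h|h]; first by rewrite mem_set.
  by rewrite memNset// => /E; rewrite (negbTE h).
rewrite lebesgue_measure_itv/= lte_fin.
have -> : `|c| = `|c'| by rewrite /c' normrM; case: (he ord0) => ->; rewrite ?normrN normr1 mul1r.
case: (ger0P c') => h0; case: (leP 0 c') => h1; case: (leP 1 (c' + 1)) => h2.
all: try (exfalso; lra).
all: match goal with |- context [Num.max 0 (1 - ?a)] => case: (leP 0 (1 - a)) => h3 end.
all: case: ifPn; rewrite ?ltNge ?negbK => h4; rewrite -?EFinB; congr EFin; lra.
Qed.

(** Slicing a slab along its first coordinate gives slabs of lower dimension
with a shifted center, so that the volumes obey the recursion of
[sinc_fourier_rec]. *)
Lemma vol_slab n (e : 'I_n.+1 -> R) c : (forall i, e i = 1 \/ e i = -1) ->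
  lebesgue_rv (slab e c) = (W^-1 * sinc_fourier n.+2 c)%:E.
Proof.
elim: n e c => [|n IH] e c he.
  by rewrite vol_slab1// sinc_fourier2 mulKf// gt_eqF// sinc_sqr_integral_gt0.
have W0 : 0 <= W^-1 by rewrite invr_ge0 ltW// sinc_sqr_integral_gt0.
have [Ik Ek] := @sinc_fourier_rec n.+2 c _ isT (he ord0).
rewrite EFinM -Ek.
rewrite -vol_lebesgue_rv vol_consE.
transitivity (\int[mu]_(x in `[0%R, 1%R]) (W^-1 * sinc_fourier n.+2 (c - e ord0 * (x - 2^-1)))%:E)%E.
  rewrite [RHS]integral_mkcond; apply: eq_integral => x _; rewrite patchE.
  case: ifPn => x01.
    rewrite -(IH (fun i => e (lift ord0 i))) => [|i]; last exact: he.
    rewrite -vol_lebesgue_rv; congr (vol _ _ _); apply/seteqP; split => y.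
      by move=> /slab_consv[].
    move=> h; apply/slab_consv; split=> //.
    by move: x01; rewrite inE/= in_itv/=.
  rewrite (_ : [set y | _] = set0) ?measure0//.
  apply/seteqP; split => // y /slab_consv[h _].
  by move: x01; rewrite notin_setE/= in_itv/= h.
under eq_integral do rewrite EFinM.
by rewrite integralZl.
Qed.

End fourier.

(** * Asymptotic expansion of powers of the cardinal sine *)

Section expansion.
Context {R : realType}.

(** The exponential series contains a multiple of [(c * (1 + s)) ^+ n.+1]. *)
Lemma pow_expN_bounded n (c : R) : 0 < c ->
  exists2 K : R, 0 <= K & forall s, 0 <= s -> (1 + s) ^+ n * expR (- (c * s)) <= K.
Proof.
move=> c0; exists (n.+1`!%:R / c ^+ n.+1 * expR c + 1).
  by rewrite addr_ge0// !mulr_ge0 ?expR_ge0// invr_ge0 exprn_ge0// ltW.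
move=> s s0.
have h : (c * (1 + s)) ^+ n.+1 / n.+1`!%:R <= expR (c * (1 + s)).
  have := expR_ge1Dxn n (_ : 0 <= c * (1 + s)); rewrite mulr_ge0 ?addr_ge0 ?(ltW c0)// => /(_ isT).
  lra.
have E : expR (c * (1 + s)) * expR (- (c * s)) = expR c.
  by rewrite -expRD; congr expR; ring.
apply: (@le_trans _ _ ((1 + s) ^+ n.+1 * expR (- (c * s)))).
  by rewrite ler_wpM2r ?expR_ge0// exprS ler_peMl ?exprn_ge0 ?lerDl ?addr_ge0.
apply: (@le_trans _ _ (n.+1`!%:R / c ^+ n.+1 * expR c)); last by rewrite lerDl.
rewrite -E mulrA ler_wpM2r ?expR_ge0//.
rewrite exprMn in h.
have f0 : 0 < n.+1`!%:R :> R by rewrite ltr0n fact_gt0.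
have cn0 : 0 < c ^+ n.+1 by rewrite exprn_gt0.
rewrite mulrAC ler_pdivlMr// -ler_pdivrMl// mulrC (mulrC _ (c ^+ n.+1)).
exact: h.
Qed.

Lemma expr_diff_le n (a b M : R) : 0 <= a <= M -> 0 <= b <= M ->
  `|a ^+ n.+1 - b ^+ n.+1| <= n.+1%:R * `|a - b| * M ^+ n.
Proof.
move=> /andP[a0 aM] /andP[b0 bM].
rewrite subrXX normrM (mulrC n.+1%:R) -mulrA ler_wpM2l//.
apply: (le_trans (ler_norm_sum _ _ _)).
rewrite -[X in X%:R]card_ord -sum1_card natr_sum mulr_suml; apply: ler_sum => i _.
rewrite mul1r normrM !normrX !ger0_norm//.
have iE : n = (n - i + i)%N by rewrite subnK// -ltnS ltn_ord.
rewrite [in leRHS]iE exprD /=.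
have M0 : 0 <= M by exact: le_trans bM.
by apply: ler_pM; rewrite ?exprn_ge0// lerXn2r// nnegrE.
Qed.

(** The coefficient of [1 / d^2] in the expansion of
[exp (- v^4 / (180 d) - v^6 / (2835 d^2))] in powers of [1 / d]. *)
Definition quad_term (v : R) : R := v ^+ 8 / (2 * 180 ^+ 2) - v ^+ 6 / (45 * 63).

(** The expansion to order [1 / d^2] of the exponential of
[d * ln (sinc (v / sqrt d)) = - v^2/6 - v^4/(180 d) - v^6/(2835 d^2) - ...]: an
Edgeworth expansion, for sums of [d] uniform variables. *)
Definition edgeworth (d : nat) (v : R) : R := expR (- (v ^+ 2 / 6)) *
  (1 - v ^+ 4 / (180 * d%:R) + quad_term v / d%:R ^+ 2).

(** In the range [|v| <= sqrt d], replace [sinc] by the exponential of its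
truncated logarithm, then expand the exponential of the non-Gaussian part [- z]
to order 2, and drop what is of order [d^-3] in the outcome. *)
Lemma sinc_pow_approx_near (d : nat) (v : R) : (1 < d)%N -> v ^+ 2 <= d%:R ->
  `|sinc (v / Num.sqrt d%:R) ^+ d - edgeworth d v| <=
   4 * (1 + v ^+ 2) ^+ 9 * expR (- (v ^+ 2 / 12)) / d%:R ^+ 3.
Proof.
move=> d0 vd.
have dR0 : 0 < d%:R :> R by rewrite ltr0n ltnW.
have dR1 : 1 <= d%:R :> R by rewrite ler1n ltnW.
pose x := v / Num.sqrt d%:R; pose q := x ^+ 2.
have qE : q = v ^+ 2 / d%:R by rewrite /q /x exprMn exprVn sqr_sqrtr// ltW.
have x1 : `|x| <= 1.
  rewrite -(@expr_le1 _ 2)// real_normK ?num_real// -/q qE ler_pdivrMr//.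
  by rewrite mul1r.
have vE : v ^+ 2 = q * d%:R by rewrite qE divfK ?gt_eqF.
have q0 : 0 <= q by rewrite sqr_ge0.
pose y := q / 6 + q ^+ 2 / 180 + q ^+ 3 / (45 * 63).
have q2 : 0 <= q ^+ 2 by rewrite exprn_ge0.
have q3 : 0 <= q ^+ 3 by rewrite exprn_ge0.
have y0 : 0 <= y by rewrite /y; lra.
(* the [d.-1] remaining factors bounded by [expR (- q / 6)] still decay like a
   Gaussian, of half the exponent since [d <= 2 * d.-1] *)
have step1 : `|sinc x ^+ d - expR (- (d%:R * y))| <= d%:R * q ^+ 4 * expR (- (v ^+ 2 / 12)).
  rewrite -mulrN expRM_natl.
  have -> : d = d.-1.+1 by rewrite prednK// ltnW.
  apply: (le_trans (expr_diff_le _ (sinc_exp_le x1) (_ : 0 <= _ <= expR (- (q / 6))))).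
    rewrite expR_ge0 ler_expR lerN2 /y; lra.
  apply: ler_pM; rewrite ?exprn_ge0 ?expR_ge0 ?mulr_ge0//.
    by rewrite ler_wpM2l//; exact: sinc_exp_approx.
  rewrite -expRM_natl ler_expR mulrN lerN2 vE.
  have : d%:R <= 2 * d.-1%:R :> R.
    by rewrite -natrM ler_nat; case: (d) d0 => // -[|k] // _; rewrite /= mul2n -addnn addSn ltnS leq_addl.
  by rewrite -[x ^+ 2]/q => h; have := ler_wpM2l q0 h; lra.
pose z := d%:R * (q ^+ 2 / 180 + q ^+ 3 / (45 * 63)).
have z0 : 0 <= z by rewrite /z mulr_ge0 ?(ltW dR0)//; lra.
have step2 : expR (- (d%:R * y)) = expR (- (v ^+ 2 / 6)) * expR (- z).
  by rewrite -expRD; congr expR; rewrite vE /y /z; field.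
have step3 : `|expR (- z) - (1 - z + z ^+ 2 / 2)| <= z ^+ 3.
  have := expRN_taylor 3 z0; have := expRN_taylor 4 z0.
  rewrite /taylor_expN !big_ord_recr big_ord0 /dpow /=.
  have -> : 3`!%:R = 6 :> R by congr (_%:R).
  have -> : 2`!%:R = 2 :> R by congr (_%:R).
  have -> : 1`!%:R = 1 :> R by [].
  move: (exprn_ge0 3 z0) => z3 g1 g2.
  by rewrite ler_norml; apply/andP; split; lra.
pose s := v ^+ 2.
have s0 : 0 <= s by rewrite sqr_ge0.
have qs : q = s / d%:R by [].
have sd k : 0 <= s ^+ k by rewrite exprn_ge0.
pose t := d%:R^-1 : R.
have t0 : 0 <= t by rewrite invr_ge0 ltW.
have t1 : t <= 1 by rewrite invf_le1.
have dt : d%:R * t = 1 by rewrite divff ?gt_eqF.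
have qt : q = s * t by [].
have zE : z = (s ^+ 2 / 180 + s ^+ 3 * t / (45 * 63)) * t.
  rewrite /z qt [RHS](_ : _ = (d%:R * t) * (s ^+ 2 / 180 + s ^+ 3 * t / (45 * 63)) * t); last by rewrite dt mul1r.
  by field.
have zle : z <= (s ^+ 2 + s ^+ 3) / d%:R.
  rewrite zE ler_wpM2r//; have := sd 2; have := sd 3.
  have : s ^+ 3 * t <= s ^+ 3 by rewrite ler_piMr.
  lra.
have step4 : `|(1 - z + z ^+ 2 / 2) - (1 - v ^+ 4 / (180 * d%:R) + quad_term v / d%:R ^+ 2)|
   <= (s ^+ 5 + s ^+ 6) / d%:R ^+ 3.
  have -> : v ^+ 4 / (180 * d%:R) = s ^+ 2 * t / 180.
    by rewrite /s /t -exprM invfM; ring.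
  have -> : quad_term v / d%:R ^+ 2 = (s ^+ 4 / (2 * 180 ^+ 2) - s ^+ 3 / (45 * 63)) * t ^+ 2.
    by rewrite /quad_term /s /t -!exprM exprVn.
  have -> : (s ^+ 5 + s ^+ 6) / d%:R ^+ 3 = (s ^+ 5 + s ^+ 6) * t ^+ 3 by rewrite /t exprVn.
  have t3 : 0 <= t ^+ 3 by rewrite exprn_ge0.
  have e : (1 - z + z ^+ 2 / 2) - (1 - s ^+ 2 * t / 180 + (s ^+ 4 / (2 * 180 ^+ 2) - s ^+ 3 / (45 * 63)) * t ^+ 2) =
     (s ^+ 5 / (180 * 45 * 63) + s ^+ 6 * t / (2 * 45 * 63 * 45 * 63)) * t ^+ 3.
    by rewrite zE; field.
  rewrite e normrM (ger0_norm t3) ler_wpM2r//.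
  have /andP[u1 u2] : 0 <= s ^+ 6 * t <= s ^+ 6 by rewrite mulr_ge0//= ler_piMr.
  move: (s ^+ 5) (s ^+ 6) (s ^+ 6 * t) (sd 5) (sd 6) u1 u2 => a b c h1 h2 h3 h4.
  by rewrite ler_norml; clear -h1 h2 h3 h4; apply/andP; split; lra.
have final : `|sinc x ^+ d - edgeworth d v| <= expR (- (v ^+ 2 / 12)) *
   (d%:R * q ^+ 4 + z ^+ 3 + (s ^+ 5 + s ^+ 6) / d%:R ^+ 3).
  have h1 : expR (- (v ^+ 2 / 6)) <= expR (- (v ^+ 2 / 12)).
    by rewrite ler_expR lerN2 -/s; lra.
  rewrite step2 in step1.
  have := ler_normD (sinc x ^+ d - expR (- (v ^+ 2 / 6)) * expR (- z))
    (expR (- (v ^+ 2 / 6)) * (expR (- z) - (1 - v ^+ 4 / (180 * d%:R) + quad_term v / d%:R ^+ 2))).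
  rewrite [X in `|X| <= _ + _](_ : _ = sinc x ^+ d - edgeworth d v); last by rewrite /edgeworth; ring.
  rewrite [in X in _ <= _ + X]normrM (ger0_norm (expR_ge0 _)).
  have := ler_normD (expR (- z) - (1 - z + z ^+ 2 / 2))
    ((1 - z + z ^+ 2 / 2) - (1 - v ^+ 4 / (180 * d%:R) + quad_term v / d%:R ^+ 2)).
  rewrite addrA subrK => k1 k2; apply: (le_trans k2).
  rewrite -(addrA (d%:R * _)) mulrDr; apply: lerD; first by apply: (le_trans step1); rewrite mulrC.
  apply: ler_pM => //.
  by apply: (le_trans k1); apply: lerD.
apply: (le_trans final).
rewrite [X in _ <= X](_ : _ = expR (- (v ^+ 2 / 12)) * (4 * (1 + s) ^+ 9 / d%:R ^+ 3)); last by rewrite /s; ring.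
rewrite ler_wpM2l ?expR_ge0//.
have -> : d%:R * q ^+ 4 = s ^+ 4 / d%:R ^+ 3.
  by rewrite qs; field; rewrite gt_eqF.
have : z ^+ 3 <= (s ^+ 2 + s ^+ 3) ^+ 3 / d%:R ^+ 3.
  by rewrite -expr_div_n lerXn2r// nnegrE// mulr_ge0 ?invr_ge0 ?addr_ge0// ltW.
move=> z3.
apply: (@le_trans _ _ ((s ^+ 4 + (s ^+ 2 + s ^+ 3) ^+ 3 + (s ^+ 5 + s ^+ 6)) / d%:R ^+ 3)).
  by rewrite [X in _ <= X]mulrDl [X in _ <= X + _]mulrDl lerD2r lerD2l.
rewrite ler_wpM2r ?invr_ge0 ?exprn_ge0 ?(ltW dR0)//.
have p k : (k <= 9)%N -> s ^+ k <= (1 + s) ^+ 9.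
  move=> k9; apply: (@le_trans _ _ ((1 + s) ^+ k)).
    by rewrite lerXn2r ?nnegrE ?addr_ge0// lerDr.
  by rewrite ler_weXn2l// lerDl.
have := p 4 isT; have := p 5 isT; have := p 6 isT.
have : (s ^+ 2 + s ^+ 3) ^+ 3 <= (1 + s) ^+ 9.
  have -> : (1 + s) ^+ 9 = ((1 + s) ^+ 3) ^+ 3 by rewrite -exprM.
  move: (sd 2) (sd 3) s0; clearbody s => s2 s3 s0.
  rewrite lerXn2r ?nnegrE ?exprn_ge0 ?addr_ge0//.
  rewrite (_ : (1 + s) ^+ 3 = s ^+ 2 + s ^+ 3 + (1 + 3 * s + 2 * s ^+ 2)); last by ring.
  by rewrite lerDl !addr_ge0 ?mulr_ge0.
lra.
Qed.

(** Two of the [d] factors give the decay in [v], and the others are at most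
[17 / 20], so that their product is smaller than any power of [1 / d]. *)
Lemma sinc_pow_far : exists2 K : R, 0 <= K & forall d v, (1 < d)%N -> d%:R < v ^+ 2 ->
  `|sinc (v / Num.sqrt d%:R) ^+ d| <= K / d%:R ^+ 3 / (1 + v ^+ 2).
Proof.
have c0 : 0 < 3 / 20 :> R by lra.
have [K0 K00 hK] := pow_expN_bounded 4 c0.
exists (2 * expR (3 / 10) * K0); first by rewrite !mulr_ge0 ?expR_ge0.
move=> d v d1 dv.
have dR0 : 0 < d%:R :> R by rewrite ltr0n ltnW.
have dR1 : 1 <= d%:R :> R by rewrite ler1n ltnW.
pose x := v / Num.sqrt d%:R.
have xx : x ^+ 2 = v ^+ 2 / d%:R by rewrite /x exprMn exprVn sqr_sqrtr// ltW.
have x1 : 1 <= `|x|.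
  rewrite -(@expr_ge1 _ 2)// real_normK ?num_real// xx ler_pdivlMr//.
  by rewrite mul1r ltW.
have v0 : 0 < v ^+ 2 by apply: lt_trans dv.
have e1 : 17 / 20 <= expR (- (3 / 20)) :> R by have := expR_ge1Dx (- (3 / 20) : R); lra.
have h2 : `|sinc x| ^+ 2 <= d%:R / v ^+ 2.
  have : (`|x| * `|sinc x|) ^+ 2 <= 1 by rewrite expr_le1 ?mulr_ge0// norm_mulr_sinc_le1.
  by rewrite exprMn real_normK ?num_real// xx -ler_pdivlMl ?divr_gt0// mulr1 invf_div.
(* [d] instead of [d - 2] in the exponent costs the factor [expR (3 / 10)] *)
have h3 : `|sinc x| ^+ (d - 2) <= expR (3 / 10) * expR (- (3 / 20 * d%:R)).
  apply: (@le_trans _ _ (expR (- (3 / 20)) ^+ (d - 2))).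
    by rewrite lerXn2r ?nnegrE ?expR_ge0// (le_trans (norm_sinc_far x1)).
  rewrite -expRM_natl -expRD ler_expR natrB//; lra.
have hd : `|sinc x| ^+ d = `|sinc x| ^+ (d - 2) * `|sinc x| ^+ 2 by rewrite -exprD subnK.
rewrite normrX -/x hd.
apply: (@le_trans _ _ (expR (3 / 10) * expR (- (3 / 20 * d%:R)) * (d%:R / v ^+ 2))).
  by apply: ler_pM => //; rewrite exprn_ge0.
have hKd := hK _ (ltW dR0).
have h4 : d%:R * expR (- (3 / 20 * d%:R)) <= K0 / d%:R ^+ 3.
  rewrite ler_pdivlMr ?exprn_gt0//; apply: le_trans hKd.
  rewrite mulrAC -exprS ler_wpM2r ?expR_ge0// lerXn2r ?nnegrE ?addr_ge0 ?(ltW dR0)//.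
  by rewrite lerDr.
have h5 : (v ^+ 2)^-1 <= 2 / (1 + v ^+ 2).
  rewrite -[leLHS]mul1r ler_pdivrMr// mulrAC ler_pdivlMr ?ltr_pwDl ?(ltW v0)//.
  by lra.
rewrite [X in X <= _](_ : _ = expR (3 / 10) * ((d%:R * expR (- (3 / 20 * d%:R))) * (v ^+ 2)^-1)); last by ring.
rewrite [X in _ <= X](_ : _ = expR (3 / 10) * ((K0 / d%:R ^+ 3) * (2 / (1 + v ^+ 2)))); last by ring.
rewrite ler_wpM2l ?expR_ge0//; apply: ler_pM => //.
by rewrite invr_ge0 ltW.
Qed.

(** When [d < v^2], each factor [1 / d] asked for costs at most a factor
[1 + v^2], which the Gaussian absorbs. *)
Lemma edgeworth_far : exists2 K : R, 0 <= K & forall d v, (1 < d)%N -> d%:R < v ^+ 2 ->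
  `|edgeworth d v| <= K / d%:R ^+ 3 / (1 + v ^+ 2).
Proof.
have c0 : 0 < 12^-1 :> R by lra.
have [K0 K00 hK] := pow_expN_bounded 8 c0.
exists (4 * K0); first by rewrite !mulr_ge0.
move=> d v d1 dv.
have dR0 : 0 < d%:R :> R by rewrite ltr0n ltnW.
have dR1 : 1 <= d%:R :> R by rewrite ler1n ltnW.
pose s := v ^+ 2; pose t := d%:R^-1 : R.
have s0 : 0 <= s by rewrite sqr_ge0.
have t0 : 0 <= t by rewrite invr_ge0 ltW.
have t1 : t <= 1 by rewrite invf_le1.
have st1 : 1 <= s * t by rewrite /t ler_pdivlMr// mul1r ltW.
have hs := hK s s0.
rewrite /edgeworth normrM ger0_norm ?expR_ge0//.
have A : `|1 - v ^+ 4 / (180 * d%:R) + quad_term v / d%:R ^+ 2| <= 4 * (1 + s) ^+ 4.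
  have -> : v ^+ 4 / (180 * d%:R) = s ^+ 2 * t / 180.
    by rewrite /s /t -exprM invfM; ring.
  have -> : quad_term v / d%:R ^+ 2 = s ^+ 4 * t ^+ 2 / (2 * 180 ^+ 2) - s ^+ 3 * t ^+ 2 / (45 * 63).
    by rewrite /quad_term /s /t -!exprM exprVn; ring.
  have p k : 0 <= s ^+ k <= (1 + s) ^+ k by rewrite exprn_ge0// lerXn2r ?nnegrE ?addr_ge0// lerDr.
  have p4 k : (k <= 4)%N -> 0 <= s ^+ k <= (1 + s) ^+ 4.
    move=> k4; have /andP[-> /le_trans->//] := p k.
    by rewrite ler_weXn2l// lerDl.
  have t2 : 0 <= t ^+ 2 <= 1 by rewrite exprn_ge0// exprn_ile1.
  have /andP[s2 s2'] := p4 2 isT; have /andP[s3 s3'] := p4 3 isT; have /andP[s4 s4'] := p4 4 isT.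
  have u2 : 0 <= s ^+ 2 * t <= s ^+ 2 by rewrite mulr_ge0//= ler_piMr.
  have u3 : 0 <= s ^+ 3 * t ^+ 2 <= s ^+ 3 by case/andP: t2 => ? ?; rewrite mulr_ge0//= ler_piMr.
  have u4 : 0 <= s ^+ 4 * t ^+ 2 <= s ^+ 4 by case/andP: t2 => ? ?; rewrite mulr_ge0//= ler_piMr.
  have w1 : 1 <= (1 + s) ^+ 4 by rewrite exprn_ege1// lerDl.
  move: (s ^+ 2 * t) (s ^+ 3 * t ^+ 2) (s ^+ 4 * t ^+ 2) u2 u3 u4 => a b c /andP[? ?] /andP[? ?] /andP[? ?].
  by rewrite ler_norml; apply/andP; split; lra.
have B : 1 <= (1 + s) ^+ 3 * t ^+ 3.
  by rewrite -exprMn exprn_ege1// mulrDl; lra.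
have C : expR (- (s / 6)) <= expR (- (12^-1 * s)) by rewrite ler_expR lerN2; lra.
have s1 : 0 < 1 + s by rewrite ltr_pwDl.
rewrite -/s; have -> : 4 * K0 / d%:R ^+ 3 = 4 * K0 * t ^+ 3 by rewrite /t exprVn.
rewrite ler_pdivlMr//.
apply: (@le_trans _ _ (expR (- (12^-1 * s)) * (4 * (1 + s) ^+ 4) * (1 + s))).
  by rewrite ler_wpM2r ?(ltW s1)// ler_pM ?expR_ge0.
apply: (@le_trans _ _ (expR (- (12^-1 * s)) * (4 * (1 + s) ^+ 4) * (1 + s) * ((1 + s) ^+ 3 * t ^+ 3))).
  by rewrite ler_peMr// !mulr_ge0 ?expR_ge0 ?exprn_ge0 ?(ltW s1).
rewrite (_ : _ * (_ * t ^+ 3) = 4 * ((1 + s) ^+ 8 * expR (- (12^-1 * s))) * t ^+ 3); last by ring.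
by rewrite ler_wpM2r ?exprn_ge0// ler_wpM2l.
Qed.

(** The factor [1 / (1 + v ^+ 2)] makes the error integrable, with an integral
of order [d^-3]. *)
Lemma sinc_pow_approx : exists2 K : R, 0 <= K & forall d v, (1 < d)%N ->
  `|sinc (v / Num.sqrt d%:R) ^+ d - edgeworth d v| <= K / d%:R ^+ 3 / (1 + v ^+ 2).
Proof.
have c0 : 0 < 12^-1 :> R by lra.
have [K0 K00 hK] := pow_expN_bounded 10 c0.
have [K1 K10 hK1] := sinc_pow_far; have [K2 K20 hK2] := edgeworth_far.
exists (4 * K0 + K1 + K2); first by rewrite !addr_ge0 ?mulr_ge0.
move=> d v d1.
have dR0 : 0 < d%:R :> R by rewrite ltr0n ltnW.
have s1 : 0 < 1 + v ^+ 2 by rewrite ltr_pwDl ?sqr_ge0.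
have [vd|dv] := leP (v ^+ 2) d%:R.
  apply: (le_trans (sinc_pow_approx_near d1 vd)).
  rewrite ler_pdivlMr// mulrAC ler_wpM2r ?invr_ge0 ?exprn_ge0 ?(ltW dR0)//.
  apply: (@le_trans _ _ (4 * K0)); last by rewrite -addrA lerDl addr_ge0.
  rewrite -mulrA -mulrA ler_wpM2l//; have := hK _ (sqr_ge0 v).
  by rewrite (mulrC 12^-1); congr (_ <= _); rewrite exprS; ring.
apply: (le_trans (ler_normB _ _)).
apply: (@le_trans _ _ (K1 / d%:R ^+ 3 / (1 + v ^+ 2) + K2 / d%:R ^+ 3 / (1 + v ^+ 2))).
  by apply: lerD; [exact: hK1|exact: hK2].
rewrite -!mulrDl ler_wpM2r ?invr_ge0 ?(ltW s1)// ler_wpM2r ?invr_ge0 ?exprn_ge0 ?(ltW dR0)//.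
by rewrite -addrA lerDr mulr_ge0.
Qed.

End expansion.

(** * Oscillating Gaussian integrals *)

Section gaussian.
Context {R : realType}.
Local Notation mu := (@lebesgue_measure R).

(** Integrate over [[- n, n]] and let [n] grow: the boundary terms vanish. *)
Lemma Rintegral_derive_eq0 (F f : R -> R) (C C' : R) :
  (forall x : R, is_derive x 1 F (f x)) -> continuous f ->
  (forall u, `|f u| <= C / (1 + u ^+ 2)) ->
  (forall u, `|F u| <= C' / (1 + u ^+ 2)) -> \int[mu]_u f u = 0.
Proof.
move=> dF cf fC FC.
have mf : measurable_fun setT f by exact: continuous_measurable_fun.
pose D n : set R := `[- n.+1%:R, n.+1%:R]%classic.
pose f_ n (x : R) : \bar R := (\1_(D n) x * f x)%:E.
have mf_ n : measurable_fun setT (f_ n).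
  apply/measurable_EFinP; apply: measurable_funM => //; exact: measurable_indic (measurable_itv _).
have Ig : mu.-integrable setT (fun u : R => (C * (1 + u ^+ 2)^-1)%:E).
  by apply: integrable_EFinZ; exact: integrable_invD1sqr.
have cvgf : {ae mu, forall x, setT x -> f_ ^~ x @ \oo --> (EFin \o f) x}.
  apply: aeW => x _; apply: cvg_near_cst; near=> n.
  suff xD : x \in D n by rewrite /f_ indicE xD mul1r.
  rewrite inE /D /= in_itv/= -ler_norml.
  apply: (@le_trans _ _ n%:R); last by rewrite ler_nat.
  near: n; exact: nbhs_infty_ger.
have fg : {ae mu, forall x n, setT x -> `|f_ n x| <= (C * (1 + x ^+ 2)^-1)%:E}%E.
  apply: aeW => x n _; rewrite /f_ abse_EFin lee_fin normrM.
  apply: le_trans (fC x); rewrite ler_piMl// indicE.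
  by case: (x \in _); rewrite ?normr1 ?normr0.
have [If _ cvgI] := @dominated_convergence _ _ _ mu _ measurableT f_ (EFin \o f) _ mf_
  (proj2 (measurable_EFinP _ _) mf) cvgf Ig fg.
have IE n : (\int[mu]_x f_ n x = (F n.+1%:R - F (- n.+1%:R))%:E)%E.
  rewrite /f_ -integral_indicr; last exact: measurable_itv.
  have n0 : 0 < n.+1%:R :> R by [].
  rewrite (@continuous_FTC2 _ f F)//.
  - by lra.
  - exact: continuous_subspaceT.
  - split.
    + by move=> x _; case: (dF x).
    + apply: cvg_at_right_filter; apply/differentiable_continuous/derivable1_diffP.
      by case: (dF (- n.+1%:R)).
    + apply: cvg_at_left_filter; apply/differentiable_continuous/derivable1_diffP.
      by case: (dF n.+1%:R).
  - by move=> x _; rewrite derive1E; case: (dF x).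
have cvgF : (fun n => F n.+1%:R - F (- n.+1%:R)) @ \oo --> 0.
  apply: norm_cvg0.
  have C'0 : 0 <= C' by have := FC 0; rewrite expr0n/= addr0 divr1; exact: le_trans.
  have h : (fun n => 2 * C' * harmonic n) @ \oo --> 0.
    by rewrite -(mulr0 (2 * C')); apply: cvgM; [exact: cvg_cst|exact: cvg_harmonic].
  apply: (squeeze_cvgr _ (cvg_cst 0) h).
  apply: nearW => n; rewrite normr_ge0/=.
  apply: (le_trans (ler_normB _ _)).
  have n1 : 1 <= n.+1%:R :> R by rewrite ler1n.
  have k : C' / (1 + n.+1%:R ^+ 2) <= C' * harmonic n.
    rewrite ler_wpM2l// /harmonic/= lef_pV2 ?posrE ?ltr_pwDl ?sqr_ge0//.
    by nra.
  rewrite (_ : 2 * C' * harmonic n = C' * harmonic n + C' * harmonic n); last by ring.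
  apply: lerD; apply: le_trans k; first exact: FC.
  by rewrite -[n.+1%:R ^+ 2]sqrrN; exact: FC.
have : (fun n => (F n.+1%:R - F (- n.+1%:R))%:E) @ \oo --> (\int[mu]_u f u)%:E.
  rewrite -EFin_Rintegral//.
  apply: cvg_trans cvgI; apply: near_eq_cvg; apply: nearW => n /=.
  by rewrite IE.
move=> /fine_cvg /= => h.
by apply: (cvg_unique _ h cvgF).
Unshelve. all: by end_near. Qed.

Definition gauss (v : R) : R := expR (- (v ^+ 2 / 6)).

Lemma is_derive_gauss (v : R) : is_derive v 1 gauss (- (v / 3) * gauss v).
Proof.
have -> : gauss = expR \o ((- 6^-1) \*: (@idfun R ^+ 2)).
  apply/funext => x; rewrite /gauss /=; congr expR.
  by rewrite -[RHS]/(- 6^-1 * (x * x)); ring.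
apply: is_derive_eq.
rewrite -[_ *: _]/(_ * _) -[_%:A]/(_ * _) !mulr1 mulrC /=.
rewrite expr1; congr (_ * _); by field.
Qed.

Lemma continuous_derive (F f : R -> R) : (forall x : R, is_derive x 1 F (f x)) -> continuous F.
Proof.
by move=> dF x; apply/differentiable_continuous/derivable1_diffP; case: (dF x).
Qed.

Lemma is_derive_cosM (b v : R) : is_derive v 1 (fun u => cos (b * u)) (- b * sin (b * v)).
Proof.
have -> : (fun u => cos (b * u)) = cos \o (b \*: @idfun R) by [].
by apply: is_derive_eq; rewrite -[_%:A]/(_ * _) mulr1 mulrC mulNr mulrN.
Qed.

Lemma is_derive_sinM (b v : R) : is_derive v 1 (fun u => sin (b * u)) (b * cos (b * v)).
Proof.
have -> : (fun u => sin (b * u)) = sin \o (b \*: @idfun R) by [].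
by apply: is_derive_eq; rewrite -[_%:A]/(_ * _) mulr1 mulrC.
Qed.

Lemma gauss_mul_le m : exists2 K : R, 0 <= K & forall C p v, 0 <= C ->
  `|p| <= C * (1 + v ^+ 2) ^+ m -> `|gauss v * p| <= C * K / (1 + v ^+ 2).
Proof.
have c0 : 0 < 6^-1 :> R by lra.
have [K K0 hK] := pow_expN_bounded m.+1 c0.
exists K => // C p v C0 pC.
have v1 : 0 < 1 + v ^+ 2 by rewrite ltr_pwDl ?sqr_ge0.
rewrite ler_pdivlMr// normrM ger0_norm ?expR_ge0//.
apply: (@le_trans _ _ (gauss v * (C * (1 + v ^+ 2) ^+ m) * (1 + v ^+ 2))).
  by rewrite ler_wpM2r ?(ltW v1)// ler_wpM2l// expR_ge0.
rewrite (_ : _ * _ * _ = C * ((1 + v ^+ 2) ^+ m.+1 * gauss v)); last by rewrite (exprS _ m); ring.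
rewrite ler_wpM2l//; have := hK _ (sqr_ge0 v).
by rewrite /gauss (mulrC 6^-1).
Qed.

Lemma norm_pow_le (v : R) k m : (k <= m.*2)%N -> `|v ^+ k| <= (1 + v ^+ 2) ^+ m.
Proof.
move=> km; rewrite normrX.
have v1 : 1 <= 1 + v ^+ 2 by rewrite lerDl sqr_ge0.
have [h|h] := leP `|v| 1.
  by apply: (@le_trans _ _ 1); [rewrite exprn_ile1|rewrite exprn_ege1].
apply: (@le_trans _ _ (`|v| ^+ m.*2)); first by rewrite ler_weXn2l// ltW.
rewrite -mul2n exprM real_normK ?num_real// lerXn2r ?nnegrE ?sqr_ge0 ?addr_ge0 ?sqr_ge0//.
by rewrite lerDr.
Qed.

Definition gauss_fourier (b : R) : R := \int[mu]_v (gauss v * cos (b * v)).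

Lemma continuous_gauss : continuous gauss.
Proof. exact: continuous_derive is_derive_gauss. Qed.

Lemma continuous_cosM (b : R) : continuous (fun v => cos (b * v)).
Proof. exact: continuous_derive (is_derive_cosM b). Qed.

Lemma continuous_sinM (b : R) : continuous (fun v => sin (b * v)).
Proof. exact: continuous_derive (is_derive_sinM b). Qed.

Lemma gauss_trig_le m : exists2 K : R, 0 <= K & forall k p v, (k <= m.*2)%N ->
  `|p| <= 1 -> `|gauss v * (v ^+ k * p)| <= K / (1 + v ^+ 2).
Proof.
have [K K0 hK] := gauss_mul_le m; exists K => // k p v km p1.
have := hK 1 (v ^+ k * p) v ler01; rewrite !mul1r; apply.
rewrite normrM; apply: le_trans (norm_pow_le _ km).
by rewrite ler_piMr.
Qed.

Lemma integrable_gauss_trig k (T : R -> R) : continuous T -> (forall v, `|T v| <= 1) ->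
  mu.-integrable setT (fun v : R => (gauss v * (v ^+ k * T v))%:E).
Proof.
move=> cT T1; have [K K0 hK] := gauss_trig_le k.
apply: (@integrable_le_invD1sqr _ _ K); last first.
  by move=> v; apply: hK => //; rewrite -addnn leq_addr.
apply: measurable_funM; first by apply: continuous_measurable_fun; exact: continuous_gauss.
apply: measurable_funM; first exact: measurable_funX.
exact: continuous_measurable_fun.
Qed.

Lemma norm_cos_le1 (x : R) : `|cos x| <= 1.
Proof. exact: cos_max. Qed.

Lemma norm_sin_le1 (x : R) : `|sin x| <= 1.
Proof. exact: sin_max. Qed.

Lemma integrable_gauss_cos k (b : R) :
  mu.-integrable setT (fun v : R => (gauss v * (v ^+ k * cos (b * v)))%:E).
Proof.
by apply: integrable_gauss_trig => [|v]; [exact: continuous_cosM|exact: norm_cos_le1].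
Qed.

Lemma integrable_gauss_sin k (b : R) :
  mu.-integrable setT (fun v : R => (gauss v * (v ^+ k * sin (b * v)))%:E).
Proof.
by apply: integrable_gauss_trig => [|v]; [exact: continuous_sinM|exact: norm_sin_le1].
Qed.

Lemma integrable_gauss_cos0 (b : R) :
  mu.-integrable setT (fun v : R => (gauss v * cos (b * v))%:E).
Proof.
by apply: eq_integrable (integrable_gauss_cos 0 b) => // v _; rewrite mul1r.
Qed.

(** Integration by parts: the difference of the two sides is the integral of
the derivative of [3 * gauss v * sin (b * v)]. *)
Lemma gauss_sin_moment (b : R) :
  \int[mu]_v (gauss v * (- v * sin (b * v))) = - (3 * b) * gauss_fourier b.
Proof.
pose F v := 3 * (gauss v * sin (b * v)).
pose f v := gauss v * (- v * sin (b * v)) + 3 * b * (gauss v * cos (b * v)).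
have dF (v : R) : is_derive v 1 F (f v).
  have -> : F = 3 \*: (gauss * (fun v => sin (b * v))) by apply/funext.
  have d1 := is_derive_gauss v; have d2 := is_derive_sinM b v.
  apply: is_derive_eq; rewrite -![_ *: _]/(_ * _) /f.
  by field.
have [K K0 hK] := gauss_trig_le 1.
have hs u : `|gauss u * (- u * sin (b * u))| <= K / (1 + u ^+ 2).
  by have := hK 1 _ u isT (norm_sin_le1 (b * u)); rewrite mulNr mulrN normrN.
have h0 k u (T : R) : `|T| <= 1 -> `|k * (gauss u * T)| <= `|k| * K / (1 + u ^+ 2).
  move=> T1; rewrite normrM -mulrA ler_wpM2l//.
  by have := hK 0 _ u isT T1; rewrite mul1r.
have I1 : mu.-integrable setT (fun v : R => (gauss v * (- v * sin (b * v)))%:E).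
  have := integrable_EFinZ (-1) (integrable_gauss_sin 1 b).
  by apply: eq_integrable => // v _; congr EFin; ring.
have I2 : mu.-integrable setT (fun v : R => (3 * b * (gauss v * cos (b * v)))%:E).
  by apply: integrable_EFinZ; exact: integrable_gauss_cos0.
have : \int[mu]_v f v = 0.
  apply: (@Rintegral_derive_eq0 F f (K + `|3 * b| * K) (`|3| * K)) => //.
  - move=> v; rewrite /f; apply: cvgD; apply: cvgM.
    + exact: continuous_gauss.
    + apply: cvgM; last exact: continuous_sinM.
      by apply: cvgN.
    + exact: cvg_cst.
    + by apply: cvgM; [exact: continuous_gauss|exact: continuous_cosM].
  - move=> u; rewrite /f [leRHS]mulrDl; apply: (le_trans (ler_normD _ _)).
    by apply: lerD => //; apply: h0; exact: norm_cos_le1.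
  - by move=> u; apply: h0; exact: norm_sin_le1.
rewrite RintegralD// RintegralZl//; last exact: integrable_gauss_cos0.
by rewrite /gauss_fourier; lra.
Qed.

(** Differentiation under the integral sign brings down the integral of
[gauss_sin_moment]. *)
Lemma is_derive_gauss_fourier (b : R) :
  is_derive b 1 gauss_fourier (- (3 * b) * gauss_fourier b).
Proof.
have [K K0 hK] := gauss_trig_le 1.
pose G (v : R) := K * (1 + v ^+ 2)^-1.
pose f (x v : R) := gauss v * cos (x * v).
have df (x v : R) : is_derive x 1 (f ^~ v) (gauss v * (- v * sin (x * v))).
  have -> : f ^~ v = gauss v \*: (fun x => cos (v * x)).
    by apply/funext => y; rewrite /f mulrC [RHS]mulrC (mulrC y).
  have d := is_derive_cosM v x.
  by apply: is_derive_eq; rewrite -[_ *: _]/(_ * _) (mulrC x).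
have d1E x v : partial1of2 f x v = gauss v * (- v * sin (x * v)).
  by rewrite partial1of2E; case: (df x v).
(* any bounded interval around [b] would do: the bound [G] is global *)
have bI : (`]b - 1, b + 1[%classic : set R) b by rewrite /= in_itv/=; apply/andP; split; lra.
have If x : (`]b - 1, b + 1[%classic : set R) x -> mu.-integrable setT (EFin \o f x).
  by move=> _; exact: integrable_gauss_cos0.
have G0 v : 0 <= G v by rewrite mulr_ge0// invr_ge0 addr_ge0// sqr_ge0.
have IG : mu.-integrable setT (EFin \o G).
  by apply: integrable_EFinZ; exact: integrable_invD1sqr.
have dG x v : (`]b - 1, b + 1[%classic : set R) x -> setT v -> `|partial1of2 f x v| <= G v.
  move=> _ _; rewrite d1E mulNr mulrN normrN.
  by have := hK 1 _ v isT (norm_sin_le1 (x * v)).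
have df' x v : (`]b - 1, b + 1[%classic : set R) x -> setT v -> derivable (f ^~ v) x 1.
  by move=> _ _; case: (df x v).
apply: DeriveDef.
  exact: (derivable_under_integral measurableT bI If df' G0 IG dG).
rewrite -derive1E (differentiation_under_integral measurableT bI If df' G0 IG dG).
rewrite -gauss_sin_moment; apply: eq_Rintegral => v _.
exact: d1E.
Qed.

(** The differential equation of [is_derive_gauss_fourier] makes
[expR (3 * b ^+ 2 / 2) * gauss_fourier b] constant. *)
Lemma gauss_fourier_gt0 (b : R) : 0 < gauss_fourier b.
Proof.
pose H (x : R) := expR (3 * x ^+ 2 / 2) * gauss_fourier x.
have dH (x : R) : is_derive x 1 H 0.
  have -> : H = (expR \o ((3 / 2) \*: (@idfun R ^+ 2))) * gauss_fourier.
    apply/funext => y; rewrite /H; congr (expR _ * _).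
    by rewrite -[RHS]/(3 / 2 * (y * y)); ring.
  have d := is_derive_gauss_fourier x.
  apply: is_derive_eq; rewrite -![_ *: _]/(_ * _) expr1.
  rewrite -[(expR \o _) x]/(expR (((3 / 2) \*: (@idfun R ^+ 2)) x)) -[idfun x]/x.
  by field.
have h0 : 0 < gauss_fourier 0.
  rewrite /gauss_fourier; under eq_Rintegral do rewrite mul0r cos0 mulr1.
  apply: Rintegral_gt0.
  - apply: eq_integrable (integrable_gauss_cos0 0) => // v _.
    by rewrite mul0r cos0 mulr1.
  - by move=> u; exact: expR_ge0.
  - move=> u /andP[u0 u1]; have u2 : u ^+ 2 <= 1 by rewrite expr_le1.
    by apply: le_trans (expR_ge1Dx _); lra.
have e := is_derive_0_is_cst b 0 dH.
have : 0 < H b by rewrite e /H mulr_gt0// expR_gt0.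
by rewrite pmulr_rgt0// expR_gt0.
Qed.

(** Four integrations by parts at once: [P] and [Q] solve the linear system
which says that the derivative of [gauss * (P cos + Q sin)] has no sine part and
that its cosine part is [v ^+ 4 - c]; the constant [c] is then forced. *)
Lemma gauss_moment4 (b : R) : \int[mu]_v (gauss v * (v ^+ 4 * cos (b * v))) =
  27 * (1 - 6 * b ^+ 2 + 3 * b ^+ 4) * gauss_fourier b.
Proof.
pose c : R := 27 * (1 - 6 * b ^+ 2 + 3 * b ^+ 4).
pose P (v : R) := - 3 * v ^+ 3 + (27 * b ^+ 2 - 27) * v.
pose Q (v : R) := 9 * b * v ^+ 2 + (135 - 81 * b ^+ 2) * b.
pose F v := gauss v * (P v * cos (b * v) + Q v * sin (b * v)).
pose f v := gauss v * (v ^+ 4 * cos (b * v)) + - c * (gauss v * cos (b * v)).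
have dP (v : R) : is_derive v 1 P (- 9 * v ^+ 2 + (27 * b ^+ 2 - 27)).
  have -> : P = (- 3) \*: (@idfun R ^+ 3) + (27 * b ^+ 2 - 27) \*: @idfun R by apply/funext.
  by apply: is_derive_eq; rewrite -![_ *: _]/(_ * _) /= ; ring.
have dQ (v : R) : is_derive v 1 Q (18 * b * v).
  have -> : Q = (9 * b) \*: (@idfun R ^+ 2) + cst ((135 - 81 * b ^+ 2) * b) by apply/funext.
  by apply: is_derive_eq; rewrite -![_ *: _]/(_ * _) /=; ring.
have dF (v : R) : is_derive v 1 F (f v).
  have -> : F = gauss * (P * (fun v => cos (b * v)) + Q * (fun v => sin (b * v))) by apply/funext.
  have d1 := is_derive_gauss v; have d2 := is_derive_sinM b v; have d3 := is_derive_cosM b v.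
  have d4 := dP v; have d5 := dQ v.
  apply: is_derive_eq; rewrite -![_ *: _]/(_ * _) !fctE /f /P /Q /c.
  by field.
have [K K0 hK] := gauss_trig_le 2.
have hk k a u (T : R) : (k <= 4)%N -> `|T| <= 1 ->
    `|gauss u * (a * u ^+ k * T)| <= `|a| * K / (1 + u ^+ 2).
  move=> k4 T1; rewrite -!(mulrA a) mulrCA normrM -mulrA ler_wpM2l//.
  exact: hK.
have c1 v := norm_cos_le1 (b * v); have s1 v := norm_sin_le1 (b * v).
have I0 := integrable_gauss_cos0 b; have I4 := integrable_gauss_cos 4 b.
have : \int[mu]_v f v = 0.
  apply: (@Rintegral_derive_eq0 F f (`|1| * K + `|- c| * K)
    (`|- 3| * K + `|27 * b ^+ 2 - 27| * K + (`|9 * b| * K + `|(135 - 81 * b ^+ 2) * b| * K))) => //.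
  - move=> v; rewrite /f; apply: cvgD; apply: cvgM.
    + exact: continuous_gauss.
    + apply: cvgM; last exact: continuous_cosM.
      exact: exprn_continuous.
    + exact: cvg_cst.
    + by apply: cvgM; [exact: continuous_gauss|exact: continuous_cosM].
  - move=> u; rewrite /f [leRHS]mulrDl; apply: (le_trans (ler_normD _ _)).
    apply: lerD; first by have := hk 4 1 u _ isT (c1 u); rewrite mul1r.
    by have := hk 0 (- c) u _ isT (c1 u); rewrite expr0 mulr1 mulrCA.
  - move=> u.
    have -> : F u = gauss u * (- 3 * u ^+ 3 * cos (b * u)) + gauss u * ((27 * b ^+ 2 - 27) * u ^+ 1 * cos (b * u))
      + (gauss u * (9 * b * u ^+ 2 * sin (b * u)) + gauss u * ((135 - 81 * b ^+ 2) * b * u ^+ 0 * sin (b * u))).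
      by rewrite /F /P /Q; ring.
    rewrite [leRHS]mulrDl [X in _ <= X + _]mulrDl [X in _ <= _ + X]mulrDl.
    apply: (le_trans (ler_normD _ _)); apply: lerD.
      by apply: (le_trans (ler_normD _ _)); apply: lerD; exact: hk.
    by apply: (le_trans (ler_normD _ _)); apply: lerD; exact: hk.
rewrite RintegralD//; last exact: integrable_EFinZ.
rewrite RintegralZl// /c /gauss_fourier; lra.
Qed.

End gaussian.

(** * Asymptotics of the section volumes *)

Section asymptotics.
Context {R : realType}.
Local Notation mu := (@lebesgue_measure R).
Local Notation W := (@sinc_sqr_integral R).

(** Polya's formula: the substitution [u = v / sqrt d] in [vol_slab] cancels
the factor [sqrt d] of [section_volumeE]. *)
Lemma section_volume_integral d (t : R) : (1 < d)%N -> 0 <= t ->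
  mu.-integrable setT (fun v => (sinc (v / Num.sqrt d%:R) ^+ d * cos (2 * t * v))%:E) /\
  section_volume d t = W^-1 * \int[mu]_v (sinc (v / Num.sqrt d%:R) ^+ d * cos (2 * t * v)).
Proof.
case: d => [|[|n]]// _ t0; pose q : R := Num.sqrt n.+2%:R.
have q0 : 0 < q by rewrite sqrtr_gt0.
have qV0 : q^-1 != 0 by rewrite invr_eq0 gt_eqF.
have qK : t * q * q^-1 = t by rewrite mulfK// gt_eqF.
have E v : sinc (q^-1 * v + 0) ^+ n.+2 * cos (2 * (t * q) * (q^-1 * v + 0)) =
    sinc (v / q) ^+ n.+2 * cos (2 * t * v).
  rewrite (_ : 2 * (t * q) * (q^-1 * v + 0) = 2 * (t * q * q^-1) * v); last by ring.
  by rewrite qK addr0 (mulrC q^-1).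
have [I1 e1] := Rintegral_affine 0 qV0 (@integrable_sinc_cos R n.+2 (t * q) isT).
split; first by apply: eq_integrable I1 => // v _; rewrite E.
rewrite (@section_volumeE _ _ (fun c => W^-1 * sinc_fourier n.+2 c))//.
- rewrite -/q /sinc_fourier e1 gtr0_norm ?invr_gt0//.
  under eq_Rintegral do rewrite E.
  by rewrite mulrCA [q * _]mulrA mulfV ?mul1r// gt_eqF.
- by move=> c; rewrite sinc_fourierN.
- exact: vol_slab.
Qed.

(** The expansion [edgeworth] is integrated term by term, and the error bound
of [sinc_pow_approx] is integrated as well. *)
Lemma section_volume_expansion (t : R) : 0 <= t -> exists a0 a2 K : R,
  forall d, (1 < d)%N -> `|section_volume d t -
    (a0 - (W^-1 * \int[mu]_v (gauss v * (v ^+ 4 * cos (2 * t * v))) / 180) / d%:R + a2 / d%:R ^+ 2)| <= K / d%:R ^+ 3.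
Proof.
move=> t0; have [K K0 hK] := @sinc_pow_approx R.
have I0 := integrable_gauss_cos0 (2 * t).
have I4 := integrable_gauss_cos 4 (2 * t).
have I6 := integrable_gauss_cos 6 (2 * t).
have I8 := integrable_gauss_cos 8 (2 * t).
have IQ : mu.-integrable setT (fun v => (gauss v * (quad_term v * cos (2 * t * v)))%:E).
  have := integrable_EFinD (integrable_EFinZ ((2 * 180 ^+ 2)^-1) I8) (integrable_EFinZ (- (45 * 63)^-1) I6).
  by apply: eq_integrable => // v _; congr EFin; rewrite /quad_term; ring.
set M4 := \int[mu]_v (gauss v * (v ^+ 4 * cos (2 * t * v))).
pose M0 := \int[mu]_v (gauss v * cos (2 * t * v)).
pose M8 := \int[mu]_v (gauss v * (quad_term v * cos (2 * t * v))).
pose C := \int[mu]_v (1 + v ^+ 2)^-1.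
exists (W^-1 * M0), (W^-1 * M8), (W^-1 * K * C) => d d1.
have [Is ->] := section_volume_integral d1 t0.
have W0 : 0 <= W^-1 by rewrite invr_ge0 ltW// sinc_sqr_integral_gt0.
have I04 := integrable_EFinD I0 (integrable_EFinZ (- (180 * d%:R)^-1) I4).
have I048 := integrable_EFinD I04 (integrable_EFinZ ((d%:R ^+ 2)^-1) IQ).
have aE v : gauss v * cos (2 * t * v) + - (180 * d%:R)^-1 * (gauss v * (v ^+ 4 * cos (2 * t * v)))
   + (d%:R ^+ 2)^-1 * (gauss v * (quad_term v * cos (2 * t * v))) = edgeworth d v * cos (2 * t * v).
  by rewrite /edgeworth -/(gauss v); ring.
have Ia : mu.-integrable setT (fun v => (edgeworth d v * cos (2 * t * v))%:E).
  by apply: eq_integrable I048 => // v _; rewrite aE.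
have e : \int[mu]_v (edgeworth d v * cos (2 * t * v)) = M0 - M4 / (180 * d%:R) + M8 / d%:R ^+ 2.
  under eq_Rintegral do rewrite -aE.
  rewrite RintegralD//; last exact: integrable_EFinZ.
  rewrite RintegralD//; last exact: integrable_EFinZ.
  rewrite RintegralZl// RintegralZl//.
  by rewrite -/M0 -/M4 -/M8; ring.
rewrite [X in `|_ - X|](_ : _ = W^-1 * (M0 - M4 / (180 * d%:R) + M8 / d%:R ^+ 2)); last first.
  by rewrite (invfM 180); ring.
rewrite -e -mulrBr normrM (ger0_norm W0).
rewrite -RintegralB//.
rewrite -!mulrA ler_wpM2l//.
rewrite [leRHS](_ : _ = K / d%:R ^+ 3 * C); last by ring.
have mI : measurable_fun setT (fun v : R => sinc (v / Num.sqrt d%:R) ^+ d * cos (2 * t * v) - edgeworth d v * cos (2 * t * v)).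
  apply: measurable_funB; apply/measurable_EFinP; [exact: (measurable_int mu Is)|exact: (measurable_int mu Ia)].
apply: (le_Rintegral_invD1sqr mI) => v.
rewrite -mulrBl normrM; apply: le_trans (hK d v d1).
by rewrite ler_piMr// norm_cos_le1.
Qed.

(** The increment of [- a1 / d] is [a1 / (d (d + 1))], of exact order [d^-2],
whereas those of the other terms are of order [d^-3]. *)
Lemma eventually_increasing (f : nat -> R) (a0 a1 a2 K : R) : 0 < a1 ->
  (forall d, (1 < d)%N -> `|f d - (a0 - a1 / d%:R + a2 / d%:R ^+ 2)| <= K / d%:R ^+ 3) ->
  exists N : nat, forall d, (N < d)%N -> 0 < f d.+1 - f d.
Proof.
move=> a10 hf; pose B := (4 * `|a2| + 4 * K) / a1.
exists (Num.bound B).+1 => d dN.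
have d1 : (1 < d)%N by apply: leq_ltn_trans dN.
have := hf d d1; have := hf d.+1 (leqW d1).
rewrite -!exprVn; set y := d.+1%:R^-1; set x := d%:R^-1.
have d0 : 0 < d%:R :> R by rewrite ltr0n ltnW.
have y0 : 0 < y by rewrite invr_gt0.
have x0 : 0 < x by rewrite invr_gt0.
have dx : d%:R * x = 1 by rewrite divff// gt_eqF.
have xy : x - y = x * y.
  have dy : (1 + d%:R) * y = 1 by rewrite nat1r divff// gt_eqF.
  have -> : x - y = x * ((1 + d%:R) * y) - (d%:R * x) * y by rewrite dx dy; ring.
  by ring.
have yx : y <= x by rewrite -subr_ge0 xy mulr_ge0 ?ltW.
have x1 : x <= 1 by rewrite invf_le1// ler1n ltnW.
have xy2 : x <= 2 * y.
  have h : x * y <= y by rewrite ler_piMl// ltW.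
  by lra.
have K0 : 0 <= K.
  by have := le_trans (normr_ge0 _) (hf d d1); rewrite pmulr_lge0// invr_gt0 exprn_gt0.
have y3 : K * y ^+ 3 <= K * x ^+ 3 by rewrite ler_wpM2l// lerXn2r// nnegrE ltW.
have h2 : `|a2 * (x ^+ 2 - y ^+ 2)| <= `|a2| * (2 * x ^+ 3).
  rewrite normrM ler_wpM2l// ger0_norm; last by rewrite subr_ge0 lerXn2r// nnegrE ltW.
  rewrite subr_sqr xy; have xx : x * y <= x * x by rewrite ler_wpM2l// ltW.
  rewrite (_ : 2 * x ^+ 3 = (x * x) * (x + x)); last by ring.
  by apply: ler_pM => //; rewrite ?mulr_ge0 ?addr_ge0 ?(ltW x0) ?(ltW y0)// lerD2l.
have BdR : B < d%:R.
  apply: (lt_le_trans (archi_boundP _)); first by rewrite /B divr_ge0 ?(ltW a10)// addr_ge0// mulr_ge0.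
  by rewrite ler_nat ltnW// ltnW.
have h3 : (4 * `|a2| + 4 * K) * x < a1.
  move: BdR; rewrite /B ltr_pdivrMr// => h.
  by rewrite -(ltr_pM2l d0) mulrCA dx mulr1.
have x2 : 0 < x ^+ 2 by rewrite exprn_gt0.
have h4 : (4 * `|a2| + 4 * K) * x ^+ 3 < a1 * x ^+ 2.
  by rewrite exprS mulrA ltr_pM2r.
have h5 : a1 * x ^+ 2 <= 2 * (a1 * (x - y)).
  rewrite xy (_ : 2 * _ = a1 * (x * (2 * y))); last by ring.
  by rewrite ler_wpM2l ?(ltW a10)// expr2 ler_wpM2l// ltW.
rewrite !ler_norml => /andP[g1 g2] /andP[g3 g4].
move: h2; rewrite ler_norml => /andP[g5 g6].
lra.
Qed.

End asymptotics.

Theorem corollary1p2 (R : realType) (t : R) (ht : 0 <= t)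
    (htm : t <> gamma_minus R) (htp : t <> gamma_plus R) :
  exists N : nat, forall d : nat, (N < d)%N ->
    (0 <= t < gamma_minus R \/ gamma_plus R < t ->
       0 < section_volume d.+1 t - section_volume d t) /\
    (gamma_minus R < t < gamma_plus R ->
       section_volume d.+1 t - section_volume d t < 0).
Proof.
pose r : R := Num.sqrt (2 / 3).
have r2 : r ^+ 2 = 2 / 3 by rewrite sqr_sqrtr//; lra.
have r0 : 0 < r by rewrite sqrtr_gt0; lra.
have r1 : r < 1 by nra.
have gm0 : 0 <= gamma_minus R by rewrite mulr_ge0.
have gp0 : 0 <= gamma_plus R by rewrite mulr_ge0.
have gm2 : gamma_minus R ^+ 2 = (1 - r) / 4.
  by rewrite exprMn sqr_sqrtr -/r; [field|lra].
have gp2 : gamma_plus R ^+ 2 = (1 + r) / 4.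
  by rewrite exprMn sqr_sqrtr -/r; [field|lra].
have pE : 1 - 24 * t ^+ 2 + 48 * t ^+ 4 =
    48 * (t ^+ 2 - gamma_minus R ^+ 2) * (t ^+ 2 - gamma_plus R ^+ 2).
  rewrite gm2 gp2 [RHS](_ : _ = 48 * t ^+ 4 - 24 * t ^+ 2 + 3 * (1 - r ^+ 2)); last by field.
  by rewrite r2; field.
have W0 : 0 < (@sinc_sqr_integral R)^-1 by rewrite invr_gt0 sinc_sqr_integral_gt0.
have [a0 [a2 [K hK]]] := section_volume_expansion ht.
move: hK; rewrite gauss_moment4; set a1 := (_ / 180) => hK.
have g0 := gauss_fourier_gt0 (2 * t).
have a1E : a1 = (sinc_sqr_integral^-1 * 27 * gauss_fourier (2 * t) / 180) * (1 - 24 * t ^+ 2 + 48 * t ^+ 4).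
  by rewrite /a1; ring.
have c0 : 0 < sinc_sqr_integral^-1 * 27 * gauss_fourier (2 * t) / 180.
  by rewrite !mulr_gt0.
have lt2 (u v : R) : 0 <= u -> 0 <= v -> (u < v) = (u ^+ 2 < v ^+ 2).
  by move=> u0 v0; rewrite ltr_pXn2r// nnegrE.
have gmp : gamma_minus R < gamma_plus R by rewrite lt2// gm2 gp2; lra.
have inc : 0 < a1 -> exists N : nat, forall d, (N < d)%N ->
    0 < section_volume d.+1 t - section_volume d t.
  by move=> a10; exact: eventually_increasing a10 hK.
have dec : a1 < 0 -> exists N : nat, forall d, (N < d)%N ->
    section_volume d.+1 t - section_volume d t < 0.
  move=> a10; have [] := @eventually_increasing _ (fun d => - section_volume d t) (- a0) (- a1) (- a2) K.
  - by rewrite oppr_gt0.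
  - move=> d d1; rewrite -normrN; apply: le_trans (hK d d1).
    by rewrite le_eqVlt; apply/orP; left; apply/eqP; congr `| _ |; ring.
  - by move=> N hN; exists N => d /hN; lra.
have pos : 0 < (t ^+ 2 - gamma_minus R ^+ 2) * (t ^+ 2 - gamma_plus R ^+ 2) -> 0 < a1.
  by move=> h; rewrite a1E pE mulr_gt0// -mulrA mulr_gt0.
have neg : (t ^+ 2 - gamma_minus R ^+ 2) * (t ^+ 2 - gamma_plus R ^+ 2) < 0 -> a1 < 0.
  by move=> h; rewrite a1E pE pmulr_rlt0// -mulrA pmulr_rlt0.
have [tm|mt|//] := ltgtP t (gamma_minus R).
  have [|N hN] := inc.
    by apply: pos; rewrite nmulr_rgt0 subr_lt0 -lt2// (lt_trans tm).
  by exists N => d /hN ?; split => // /andP[]; lra.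
have [tp|pt|//] := ltgtP t (gamma_plus R).
  have [|N hN] := dec.
    by apply: neg; rewrite pmulr_rlt0 ?subr_lt0 ?subr_gt0 -lt2.
  by exists N => d /hN ?; split => // -[/andP[_]|]; lra.
have [|N hN] := inc.
  by apply: pos; rewrite mulr_gt0 ?subr_gt0 -?lt2.
by exists N => d /hN ?; split => // /andP[_]; lra.
Qed.
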